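(* For every integer $p\ge 1$, $$\begin{aligned} &\sum_{n=1}^\infty\frac{L_n^2(1)}{n^{p+1}}+\left((-1)^{p-1}-1\right)\sum_{n=1}^\infty\frac{H_nL_n(1)}{n^{p+1}}\\ &=\zeta^\star(p+1,\overline 2)-\ln 2\,\zeta^\star(p+1,\overline 1)+\zeta^\star(\overline{p+2},\overline 1)+\frac12\zeta(2)\zeta(p+1)\\ &\quad+\sum_{i=1}^{p+1}\zeta^\star(\overline i,\overline 1)\,\bar\zeta(p+2-i)+\left(p+1+(-1)^p\right)\zeta^\star(p+2,\overline 1)\\ &\quad+\frac12\ln^2 2\left\{2\zeta(p+1)+\bar\zeta(p+1)\right\}+\ln 2\,(-1)^{p-1}\left(\zeta^\star(p+1,1)-\zeta^\star(\overline{p+1},1)\right)\\ &\quad-\sum_{i=1}^{p-1}(-1)^{i-1}\bar\zeta(p+1-i)\,\zeta^\star(\overline{i+1},1)-\ln 2\left(\zeta^\star(p+1,1)-\zeta^\star(p+1,\overline 1)\right)\\ &\quad-\sum_{i=1}^{p-1}(-1)^{i-1}\bar\zeta(p+1-i)\,\bar\zeta(i+2)-\ln 2\,(-1)^{p-1}\left\{\zeta(p+2)+\bar\zeta(p+2)\right\}. \end{aligned}$$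
   Context: For integers $n,k\ge1$: $H_n=\sum_{j=1}^n \frac1j$, $L_n(k)=\sum_{j=1}^n \frac{(-1)^{j-1}}{j^k}$. $\zeta$ is the Riemann zeta function and $\bar\zeta(s)=\sum_{n=1}^\infty \frac{(-1)^{n-1}}{n^s}$ for $\Re(s)\ge 1$ (so $\bar\zeta(1)=\ln 2$). Multiple zeta-star values: for positive integers $s_1,\dots,s_k$, each possibly carrying a bar, $\zeta^\star(s_1,\dots,s_k)=\sum_{n_1\ge n_2\ge\cdots\ge n_k\ge1}\prod_{j=1}^k \frac{\varepsilon_j^{n_j}}{n_j^{s_j}}$, where $\varepsilon_j=-1$ if $s_j$ is barred and $\varepsilon_j=1$ otherwise; the series is read as the sum over $n_1$ of the finite inner sums (possibly only conditionally convergent when $s_1=\bar 1$). For instance $\zeta^\star(\bar q,p)=\sum_{m\ge1}\frac{(-1)^m}{m^q}\sum_{n=1}^m\frac1{n^p}$. Empty sums are zero. *)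

(* Defs.v *)
From Stdlib Require Import Reals List.
From Coquelicot Require Import Coquelicot.
Import ListNotations.
Open Scope R_scope.

(* Throughout, [sum_n_m f a b] is the sum of [f a .. f b], and is 0 when
   [b < a].  [Series] is indexed from 0, so sums over n >= 1 are shifted
   by [S]. *)

Definition harmonic (n : nat) : R :=
  sum_n_m (fun j => / INR j) 1 n.

Definition alt_harmonic (n k : nat) : R :=
  sum_n_m (fun j => (-1) ^ (j - 1) / INR j ^ k) 1 n.

(* The Riemann zeta function at an integer argument s >= 2. *)
Definition zeta (s : nat) : R :=
  Series (fun n => / INR (S n) ^ s).

(* The alternating zeta function at an integer argument s >= 1
   ((-1)^(n-1) is shifted to (-1)^n). *)
Definition zeta_bar (s : nat) : R :=
  Series (fun n => (-1) ^ n / INR (S n) ^ s).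

(* An argument of a multiple zeta-star value, unbarred or barred. *)
Inductive zarg : Type :=
| Plain (s : nat)
| Bar (s : nat).

Definition zarg_term (a : zarg) (n : nat) : R :=
  match a with
  | Plain s => / INR n ^ s
  | Bar s => (-1) ^ n / INR n ^ s
  end.

(* The finite sum over N >= n_1 >= n_2 >= ... >= n_k >= 1. *)
Fixpoint star_sum (l : list zarg) (N : nat) : R :=
  match l with
  | [] => 1
  | a :: l' => sum_n_m (fun n => zarg_term a n * star_sum l' n) 1 N
  end.

(* The outermost sum, over n_1, is the limit of its partial sums, so it may be
   only conditionally convergent. *)
Definition zeta_star (l : list zarg) : R :=
  match l with
  | [] => 1
  | a :: l' => Series (fun n => zarg_term a (S n) * star_sum l' (S n))
  end.

(* Main.v *)
(* Write H_n = harmonic n, L_n = alt_harmonic n 1, s = p + 1.  The theorem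
   follows from two double-sum identities by eliminating Sum_n n^(-s) Sum_(j<=n) L_j/j.

   (1) Sum (-1)^(n-1) (-1)^k H_(k-1) / (n^p k (n + k)) over n, k >= 1 in both orders.
   Summing over k first, the values U_n of Sum_k (-1)^k H_(k-1) / (n + k) satisfy a
   first-order recursion in n, whence
   (-1)^n U_n = (ln 2)^2/2 - ln 2 L_n - ln 2 H_n + Sum_(j<=n) L_j/j.
   Summing over n first, partial fractions produce the terms zeta_bar(p+1-i) and
   Sum H_k L_k / k^s.

   (2) In Sum_(i=1)^s (Sum_k (-1)^k L_k / k^i) (Sum_m (-1)^m / m^(s+1-i)), truncated at
   k, m <= M, the geometric sum over i equals (k^(-s) - m^(-s)) / (m - k) off the
   diagonal and s / k^(s+1) on it.  Collecting the powers n^(-s), their coefficients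
   converge as M grows, by recursions in n, to L_n (L_(n-1) - ln 2) + V_n, where
   V_n = Sum_(j<=n) L_j/j - H_n L_n + alt_harmonic n 2 - ((ln 2)^2 + zeta 2)/2.

   All series rearrangements are done on the finite squares n, k <= M, and the limit is
   taken with Tannery's theorem, with the summable majorant H_n / n^2. *)

Require Import Defs.
From Stdlib Require Import Reals List.
From Coquelicot Require Import Coquelicot.
From Stdlib Require Import Lia Lra.
Import ListNotations.
Open Scope R_scope.

(** * Finite sums and Tannery's theorem *)

(** Fixing the lower bound and the type R turns Coquelicot's monoid [plus] and [zero] into [+] and
    [0], so that [ring] and [lra] apply after [sum1_S]. *)
Definition sum1 (f : nat -> R) (M : nat) : R := sum_n_m f 1 M.

Lemma sum1_0 f : sum1 f 0 = 0.
Proof. unfold sum1. rewrite sum_n_m_zero; [reflexivity | lia]. Qed.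

Lemma sum1_S f M : sum1 f (S M) = sum1 f M + f (S M).
Proof. unfold sum1. rewrite sum_n_Sm; [reflexivity | lia]. Qed.

Lemma sum1_ext f g M :
  (forall k, (1 <= k <= M)%nat -> f k = g k) -> sum1 f M = sum1 g M.
Proof. intros E. apply sum_n_m_ext_loc. exact E. Qed.

Lemma sum1_shift f M : sum1 f (S M) = f 1%nat + sum1 (fun k => f (S k)) M.
Proof.
  induction M as [|M IH].
  - rewrite sum1_S, !sum1_0. ring.
  - rewrite sum1_S, IH, sum1_S. ring.
Qed.

Lemma sum1_plus f g M : sum1 (fun k => f k + g k) M = sum1 f M + sum1 g M.
Proof. induction M; [rewrite !sum1_0 | rewrite !sum1_S, IHM]; ring. Qed.

Lemma sum1_minus f g M : sum1 (fun k => f k - g k) M = sum1 f M - sum1 g M.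
Proof. induction M; [rewrite !sum1_0 | rewrite !sum1_S, IHM]; ring. Qed.

Lemma sum1_scal c f M : sum1 (fun k => c * f k) M = c * sum1 f M.
Proof. induction M; [rewrite !sum1_0 | rewrite !sum1_S, IHM]; ring. Qed.

Lemma sum1_const c M : sum1 (fun _ => c) M = INR M * c.
Proof.
  induction M; [rewrite sum1_0; simpl | rewrite sum1_S, IHM, S_INR]; ring.
Qed.

Lemma sum1_swap (f : nat -> nat -> R) M N :
  sum1 (fun i => sum1 (f i) N) M = sum1 (fun j => sum1 (fun i => f i j) M) N.
Proof.
  induction M as [|M IH].
  - rewrite sum1_0. symmetry.
    rewrite (sum1_ext _ (fun _ => 0)) by (intros; apply sum1_0).
    rewrite sum1_const. ring.
  - rewrite sum1_S, IH, <- sum1_plus. apply sum1_ext. intros k _.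
    now rewrite sum1_S.
Qed.

Lemma sum1_le f g M :
  (forall k, (1 <= k)%nat -> f k <= g k) -> sum1 f M <= sum1 g M.
Proof.
  intros E. induction M; [rewrite !sum1_0; lra | rewrite !sum1_S].
  specialize (E (S M) ltac:(lia)). lra.
Qed.

Lemma sum1_nonneg f M : (forall k, (1 <= k)%nat -> 0 <= f k) -> 0 <= sum1 f M.
Proof.
  intros E. induction M; [rewrite !sum1_0; lra | rewrite !sum1_S].
  specialize (E (S M) ltac:(lia)). lra.
Qed.

Lemma sum1_abs f M : Rabs (sum1 f M) <= sum1 (fun k => Rabs (f k)) M.
Proof.
  induction M; [rewrite !sum1_0, Rabs_R0; lra | rewrite !sum1_S].
  eapply Rle_trans; [apply Rabs_triang | lra].
Qed.

(** Lets a diagonal contribution be written as one more sum over the full range, and so be merged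
    with the off-diagonal sums term by term. *)
Lemma sum1_delta (c : nat -> R) m M : (1 <= m <= M)%nat ->
  sum1 (fun k => if Nat.eq_dec k m then c k else 0) M = c m.
Proof.
  intros Hm. induction M as [|M IH]; [lia|].
  rewrite sum1_S. destruct (Nat.eq_dec (S M) m) as [E|E].
  - rewrite (sum1_ext _ (fun _ => 0)).
    + rewrite sum1_const, E. ring.
    + intros k Hk. destruct (Nat.eq_dec k m); [lia | reflexivity].
  - rewrite IH by lia. ring.
Qed.

(** The shift is the one used by the series of the statement, which are therefore convertible to
    totals. *)
Definition total (f : nat -> R) : R := Series (fun n => f (S n)).

Lemma sum_n_sum1 (f : nat -> R) M : sum_n (fun n => f (S n)) M = sum1 f (S M).
Proof.
  induction M as [|M IH].
  - rewrite sum1_S, sum1_0, sum_O, Rplus_0_l. reflexivity.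
  - rewrite sum_Sn, IH, (sum1_S f (S M)). reflexivity.
Qed.

Lemma total_unique f (l : R) : is_lim_seq (sum1 f) l -> total f = l.
Proof.
  intros H. unfold total, Series.
  rewrite (Lim_seq_ext _ (fun n => sum1 f (S n))) by (intros; apply sum_n_sum1).
  now rewrite (is_lim_seq_unique _ _ (proj1 (is_lim_seq_incr_1 _ _) H)).
Qed.

Lemma sum1_cauchy_tail g l eps : is_lim_seq (sum1 g) (Finite l) -> 0 < eps ->
  exists N, forall M, (N <= M)%nat -> sum1 g M - sum1 g N < eps.
Proof.
  intros H He. apply is_lim_seq_spec in H.
  destruct (H (mkposreal (eps / 2) ltac:(lra))) as [N HN]. exists N.
  intros M HM. assert (h1 := HN M HM). assert (h2 := HN N (le_n N)).
  simpl in *. apply Rabs_def2 in h1. apply Rabs_def2 in h2. lra.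
Qed.

Lemma sum1_tail_abs f g N M : (N <= M)%nat ->
  (forall n, (1 <= n)%nat -> Rabs (f n) <= g n) ->
  Rabs (sum1 f M - sum1 f N) <= sum1 g M - sum1 g N.
Proof.
  intros HM Hb. induction HM as [|M HM IH].
  - rewrite !Rminus_diag, Rabs_R0. lra.
  - rewrite !sum1_S. specialize (Hb (S M) ltac:(lia)).
    replace (sum1 f M + f (S M) - sum1 f N)
      with ((sum1 f M - sum1 f N) + f (S M)) by ring.
    eapply Rle_trans; [apply Rabs_triang | lra].
Qed.

Lemma is_lim_sum1_finite (f : nat -> nat -> R) l N :
  (forall n, (1 <= n <= N)%nat -> is_lim_seq (fun M => f M n) (Finite (l n))) ->
  is_lim_seq (fun M => sum1 (f M) N) (Finite (sum1 l N)).
Proof.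
  induction N as [|N IH]; intros H.
  - apply is_lim_seq_ext with (fun _ => 0).
    + intros. now rewrite sum1_0.
    + rewrite sum1_0. apply is_lim_seq_const.
  - apply is_lim_seq_ext with (fun M => sum1 (f M) N + f M (S N)).
    + intros. now rewrite sum1_S.
    + rewrite sum1_S. apply is_lim_seq_plus'; [apply IH; intros; apply H; lia | apply H; lia].
Qed.

(** Diagonal form: [M] is both the index of the row and the length of the sum. Beyond a fixed N both
    sums are controlled by the tail of g, and the first N terms converge one by one. *)
Lemma tannery (f : nat -> nat -> R) (g l : nat -> R) (G s : R) :
  (forall M n, (1 <= n)%nat -> Rabs (f M n) <= g n) ->
  is_lim_seq (sum1 g) G ->
  (forall n, (1 <= n)%nat -> is_lim_seq (fun M => f M n) (Finite (l n))) ->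
  is_lim_seq (sum1 l) s ->
  is_lim_seq (fun M => sum1 (f M) M) s.
Proof.
  intros Hb Hg Hl Hs.
  (* The majorant passes to the pointwise limit. *)
  assert (Hbl : forall n, (1 <= n)%nat -> Rabs (l n) <= g n).
  { intros n Hn.
    apply (is_lim_seq_le (fun M => Rabs (f M n)) (fun _ => g n)
             (Finite (Rabs (l n))) (Finite (g n))).
    - intros M. now apply Hb.
    - apply (is_lim_seq_abs _ (Finite (l n))). now apply Hl.
    - apply is_lim_seq_const. }
  apply is_lim_seq_ext with (fun M => (sum1 (f M) M - sum1 l M) + sum1 l M).
  { intros; ring. }
  replace s with (0 + s) by ring. apply is_lim_seq_plus'; [|exact Hs].
  apply is_lim_seq_spec. intros eps. destruct eps as [eps He]; simpl.
  (* Three errors of size eps / 4 occur: the head, the tail of [f M] and the tail of [l]. *)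
  destruct (sum1_cauchy_tail g G (eps / 4) Hg ltac:(lra)) as [N HN].
  assert (HF := is_lim_sum1_finite f l N (fun n Hn => Hl n (proj1 Hn))). apply is_lim_seq_spec in HF.
  destruct (HF (mkposreal (eps / 4) ltac:(lra))) as [N' HN'].
  exists (Nat.max N N'). intros M HM.
  specialize (HN' M ltac:(lia)). specialize (HN M ltac:(lia)). simpl in HN'.
  assert (T1 := sum1_tail_abs (f M) g N M ltac:(lia) (Hb M)).
  assert (T2 := sum1_tail_abs l g N M ltac:(lia) Hbl).
  apply Rabs_def2 in HN'.
  apply Rabs_le_between in T1. apply Rabs_le_between in T2.
  apply Rabs_def1; lra.
Qed.

Lemma sum1_dominated f g (G : R) :
  (forall n, (1 <= n)%nat -> Rabs (f n) <= g n) ->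
  is_lim_seq (sum1 g) G -> is_lim_seq (sum1 f) (total f).
Proof.
  intros Hb Hg.
  assert (H : ex_series (fun n => f (S n))).
  { apply @ex_series_le with (fun n => g (S n)).
    - intros n. apply Hb. lia.
    - exists G. change (is_lim_seq (sum_n (fun n => g (S n))) G).
      apply (is_lim_seq_ext (fun n => sum1 g (S n))).
      + intros n. symmetry. apply sum_n_sum1.
      + now apply is_lim_seq_incr_1 in Hg. }
  apply is_lim_seq_incr_1.
  apply Series_correct in H. unfold total.
  apply (is_lim_seq_ext (sum_n (fun n => f (S n)))).
  - intros n. apply sum_n_sum1.
  - exact H.
Qed.

(** The sum starts with a minus sign and stays in [- a 1, 0]. Removing its first term leaves the
    negative of a sum of the same kind for the shifted sequence, hence the induction over all
    [a]. *)
Lemma leibniz_bound a M :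
  (forall k, (1 <= k)%nat -> 0 <= a (S k) <= a k) -> 0 <= a 1%nat ->
  Rabs (sum1 (fun k => (-1) ^ k * a k) M) <= a 1%nat.
Proof.
  intros Hd H1.
  assert (K : - a 1%nat <= sum1 (fun k => (-1) ^ k * a k) M <= 0).
  { revert a Hd H1. induction M as [|M IH]; intros a Hd H1.
    - rewrite sum1_0. lra.
    - rewrite sum1_shift.
      rewrite (sum1_ext _ (fun k => -1 * ((-1) ^ k * a (S k))))
        by (intros; simpl; ring).
      rewrite sum1_scal.
      specialize (IH (fun k => a (S k))). assert (D := Hd 1%nat (le_n 1)).
      assert (I := IH (fun k _ => Hd (S k) ltac:(lia)) ltac:(lra)).
      cbv beta in I. simpl pow. lra. }
  apply Rabs_le. lra.
Qed.

(** * Harmonic and alternating harmonic numbers *)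

Lemma harmonic_0 : harmonic 0 = 0.
Proof. exact (sum1_0 (fun j => / INR j)). Qed.

Lemma harmonic_S n : harmonic (S n) = harmonic n + / INR (S n).
Proof. exact (sum1_S (fun j => / INR j) n). Qed.

Lemma alt_harmonic_0 k : alt_harmonic 0 k = 0.
Proof. exact (sum1_0 (fun j => (-1) ^ (j - 1) / INR j ^ k)). Qed.

Lemma alt_harmonic_S n k :
  alt_harmonic (S n) k = alt_harmonic n k + (-1) ^ n / INR (S n) ^ k.
Proof.
  change (sum1 (fun j => (-1) ^ (j - 1) / INR j ^ k) (S n)
    = sum1 (fun j => (-1) ^ (j - 1) / INR j ^ k) n + (-1) ^ n / INR (S n) ^ k).
  now rewrite sum1_S, Nat.sub_1_r.
Qed.

Lemma alt_harmonic_1_S n :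
  alt_harmonic (S n) 1 = alt_harmonic n 1 + (-1) ^ n / INR (S n).
Proof. now rewrite alt_harmonic_S, pow_1. Qed.

Lemma alt_harmonic_sum1 n k :
  alt_harmonic n k = - sum1 (fun j => (-1) ^ j * / INR j ^ k) n.
Proof.
  induction n as [|n IH].
  - rewrite alt_harmonic_0, sum1_0. ring.
  - rewrite alt_harmonic_S, sum1_S, IH. simpl. unfold Rdiv. ring.
Qed.

Lemma INR_S_pos n : 0 < INR (S n).
Proof. apply lt_0_INR. lia. Qed.

Lemma INR_pos n : (1 <= n)%nat -> 0 < INR n.
Proof. intros H. apply lt_0_INR. lia. Qed.

Lemma INR_ge_1 n : (1 <= n)%nat -> 1 <= INR n.
Proof. intros H. change 1 with (INR 1). now apply le_INR. Qed.

Lemma Rabs_pow_m1 n : Rabs ((-1) ^ n) = 1.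
Proof. apply pow_1_abs. Qed.

Lemma pow_m1_sq n : (-1) ^ n * (-1) ^ n = 1.
Proof. rewrite <- Rpow_mult_distr. replace (-1 * -1) with 1 by ring. apply pow1. Qed.

Lemma harmonic_nonneg n : 0 <= harmonic n.
Proof.
  apply sum1_nonneg. intros k Hk. left. now apply Rinv_0_lt_compat, INR_pos.
Qed.

Lemma harmonic_ge_1 n : (1 <= n)%nat -> 1 <= harmonic n.
Proof.
  intros Hn. destruct n as [|n]; [lia|]. clear Hn.
  induction n as [|n IH].
  - rewrite harmonic_S, harmonic_0. simpl. lra.
  - rewrite harmonic_S. assert (H := Rinv_0_lt_compat _ (INR_S_pos (S n))). lra.
Qed.

Lemma harmonic_le n : harmonic n <= INR n.
Proof.
  induction n as [|n IH]; [rewrite harmonic_0; simpl; lra|].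
  rewrite harmonic_S, S_INR.
  assert (H : / (INR n + 1) <= 1).
  { rewrite <- Rinv_1. apply Rinv_le_contravar; [lra|].
    assert (P := pos_INR n). lra. }
  lra.
Qed.

(** A step adds 2 H_n / (n + 1) + 1 / (n + 1)^2, which is at most 3 because H_n <= n. This crude
    growth bound is enough for H_n / n to vanish. *)
Lemma harmonic_sq_le n : harmonic n ^ 2 <= 3 * INR n.
Proof.
  induction n as [|n IH]; [rewrite harmonic_0; simpl; lra|].
  rewrite harmonic_S, S_INR.
  assert (P := pos_INR n). assert (B := harmonic_le n).
  assert (B0 := harmonic_nonneg n).
  set (i := / (INR n + 1)).
  assert (I1 : (INR n + 1) * i = 1) by (unfold i; field; lra).
  assert (I0 : 0 < i) by (apply Rinv_0_lt_compat; lra).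
  assert (I2 : harmonic n * i <= 1) by nra.
  assert (I3 : i <= 1) by nra.
  nra.
Qed.

Lemma is_lim_inv_INR_S : is_lim_seq (fun n => / INR (S n)) 0.
Proof.
  apply (is_lim_seq_incr_1 (fun n => / INR n)).
  replace (Finite 0) with (Rbar_inv p_infty) by reflexivity.
  apply is_lim_seq_inv; [apply is_lim_seq_INR | discriminate].
Qed.

Lemma is_lim_harmonic_div : is_lim_seq (fun n => harmonic n / INR n) 0.
Proof.
  apply is_lim_seq_incr_1.
  apply is_lim_seq_spec. intros [eps He]; simpl.
  assert (H := is_lim_inv_INR_S). apply is_lim_seq_spec in H.
  (* By [harmonic_sq_le] the square of the quotient is at most 3 / (n + 1), to be compared with
     eps^2. *)
  destruct (H (mkposreal (eps ^ 2 / 3) ltac:(nra))) as [N HN]. exists N.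
  intros n Hn. specialize (HN n Hn). simpl in HN.
  rewrite Rminus_0_r in *. apply Rabs_def2 in HN. destruct HN as [HN _].
  change (match n with O => 1 | S _ => INR n + 1 end) with (INR (S n)) in *.
  assert (P := INR_S_pos n). assert (Q := harmonic_sq_le (S n)).
  assert (Q0 := harmonic_nonneg (S n)).
  set (x := INR (S n)) in *. set (h := harmonic (S n)) in *.
  set (i := / x) in *.
  assert (I1 : x * i = 1) by (unfold i; field; lra).
  assert (I0 : 0 < i) by (apply Rinv_0_lt_compat; lra).
  unfold Rdiv. fold i. rewrite Rabs_pos_eq by nra.
  assert (h * i * (h * i) < eps * eps).
  { assert (h ^ 2 * i * i <= 3 * x * i * i) by nra.
    replace (3 * x * i * i) with (3 * i) in * by (rewrite <- (Rmult_1_r (3 * i)), <- I1; ring).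
    lra. }
  assert (0 <= h * i) by nra. nra.
Qed.

(* Telescoping: [harmonic n / n ^ 2] is at most twice the decrement of
   [(harmonic n + 1) / n]. *)
Lemma sum1_harmonic_sq_le M : sum1 (fun n => harmonic n / INR n ^ 2) M <= 4.
Proof.
  (* The decrement from n to n + 1 pays for the term at n, so the last term is still unpaid; 4 is
     the initial value 2 (H_1 + 1) / 1. *)
  assert (K : forall M, sum1 (fun n => harmonic n / INR n ^ 2) (S M)
     <= 4 - 2 * ((harmonic (S M) + 1) / INR (S M)) + harmonic (S M) / INR (S M) ^ 2).
  { clear M. induction M as [|M IH].
    - rewrite sum1_S, sum1_0, harmonic_S, harmonic_0. simpl. lra.
    - rewrite sum1_S. rewrite (harmonic_S (S M)) in *. rewrite (S_INR (S M)).
      assert (P := INR_ge_1 (S M) ltac:(lia)).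
      assert (Q := harmonic_ge_1 (S M) ltac:(lia)).
      set (x := INR (S M)) in *. set (h := harmonic (S M)) in *.
      enough (h / x ^ 2 <= 2 * ((h + 1) / x) - 2 * ((h + / (x + 1) + 1) / (x + 1))) by lra.
      assert (E : 2 * ((h + 1) / x) - 2 * ((h + / (x + 1) + 1) / (x + 1)) - h / x ^ 2
        = (h * (x - 1) * (x + 1) + 2 * x) * / (x ^ 2 * (x + 1) ^ 2)) by (field; lra).
      assert (0 <= (h * (x - 1) * (x + 1) + 2 * x) * / (x ^ 2 * (x + 1) ^ 2)).
      { apply Rmult_le_pos.
        - assert (0 <= h * (x - 1)) by nra. nra.
        - left. apply Rinv_0_lt_compat. nra. }
      lra. }
  destruct M as [|M]; [rewrite sum1_0; lra|].
  specialize (K M). assert (P := INR_ge_1 (S M) ltac:(lia)).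
  assert (Q := harmonic_ge_1 (S M) ltac:(lia)).
  set (x := INR (S M)) in *. set (h := harmonic (S M)) in *.
  assert (h / x ^ 2 <= 2 * ((h + 1) / x)).
  { assert (E : 2 * ((h + 1) / x) - h / x ^ 2 = (h * (2 * x - 1) + 2 * x) * / x ^ 2)
      by (field; lra).
    assert (0 <= (h * (2 * x - 1) + 2 * x) * / x ^ 2).
    { apply Rmult_le_pos; [nra | left; apply Rinv_0_lt_compat; nra]. }
    lra. }
  lra.
Qed.

Lemma sum1_harmonic_sq_lim :
  exists G : R, is_lim_seq (sum1 (fun n => harmonic n / INR n ^ 2)) G.
Proof.
  apply (ex_finite_lim_seq_incr _ 4).
  - intros n. rewrite sum1_S. assert (Q := harmonic_nonneg (S n)).
    assert (P := INR_S_pos n).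
    assert (0 <= harmonic (S n) / INR (S n) ^ 2).
    { apply Rmult_le_pos; [lra|]. left. apply Rinv_0_lt_compat. nra. }
    lra.
  - apply sum1_harmonic_sq_le.
Qed.

Lemma sum1_converges f c :
  (forall n, (1 <= n)%nat -> Rabs (f n) <= c * (harmonic n / INR n ^ 2)) ->
  is_lim_seq (sum1 f) (total f).
Proof.
  intros Hb. destruct sum1_harmonic_sq_lim as [G HG].
  apply (sum1_dominated f _ (c * G) Hb).
  apply is_lim_seq_ext with (fun M => c * sum1 (fun n => harmonic n / INR n ^ 2) M).
  - intros. now rewrite sum1_scal.
  - now apply (is_lim_seq_scal_l _ c (Finite G)).
Qed.

(** * Convergence of the alternating harmonic numbers to ln 2 *)

Lemma alt_harmonic_bound n k : Rabs (alt_harmonic n k) <= 1.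
Proof.
  rewrite alt_harmonic_sum1, Rabs_Ropp.
  assert (E : / INR 1 ^ k = 1) by (simpl; rewrite pow1; apply Rinv_1).
  rewrite <- E. apply (leibniz_bound (fun j => / INR j ^ k)); [|lra].
  intros j Hj. split.
  - left. apply Rinv_0_lt_compat, pow_lt, INR_S_pos.
  - apply Rinv_le_contravar; [apply pow_lt; now apply INR_pos|].
    apply pow_incr. rewrite S_INR. assert (P := INR_pos j Hj). lra.
Qed.

Lemma sum1_alt_tail n d : sum1 (fun k => (-1) ^ k * / INR (n + k)) d
  = - (-1) ^ n * (alt_harmonic (n + d) 1 - alt_harmonic n 1).
Proof.
  induction d as [|d IH].
  - rewrite Nat.add_0_r, sum1_0. ring.
  - rewrite Nat.add_succ_r, alt_harmonic_1_S, sum1_S, Nat.add_succ_r, IH, pow_add.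
    simpl pow. unfold Rdiv.
    transitivity (- (-1) ^ n * (alt_harmonic (n + d) 1 - alt_harmonic n 1)
      - ((-1) ^ n * (-1) ^ n) * (-1) ^ d * / INR (S (n + d)));
      [rewrite pow_m1_sq|]; ring.
Qed.

Lemma sum1_alt_tail_bound n d :
  Rabs (sum1 (fun k => (-1) ^ k * / INR (n + k)) d) <= / INR (S n).
Proof.
  replace (S n) with (n + 1)%nat by lia.
  apply (leibniz_bound (fun k => / INR (n + k))).
  - intros k Hk. split.
    + left. apply Rinv_0_lt_compat, INR_pos. lia.
    + apply Rinv_le_contravar; [apply INR_pos; lia | apply le_INR; lia].
  - left. apply Rinv_0_lt_compat, INR_pos. lia.
Qed.

Lemma alt_harmonic_cauchy n d :
  Rabs (alt_harmonic (n + d) 1 - alt_harmonic n 1) <= / INR (S n).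
Proof.
  assert (B := sum1_alt_tail_bound n d).
  now rewrite sum1_alt_tail, Rabs_mult, Rabs_Ropp, Rabs_pow_m1, Rmult_1_l in B.
Qed.

(** The Catalan identity: the new negative term -1 / (2m + 2) equals 1 / (2m + 2) - 1 / (m + 1). *)
Lemma alt_harmonic_even m :
  alt_harmonic (2 * m) 1 = harmonic (2 * m) - harmonic m.
Proof.
  induction m as [|m IH].
  - simpl. rewrite alt_harmonic_0, harmonic_0. ring.
  - replace (2 * S m)%nat with (S (S (2 * m))) by lia.
    rewrite !alt_harmonic_1_S, !harmonic_S, IH, <- (tech_pow_Rmult _ (2 * m)).
    rewrite pow_1_even, !S_INR, mult_INR. simpl (INR 2).
    assert (P := pos_INR m). field. lra.
Qed.

(** Both bounds come from 1 + x <= exp x, taken at x = -1 / (n + 1) and at x = 1 / n. *)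
Lemma ln_succ_bounds n : (1 <= n)%nat ->
  / INR (S n) <= ln (INR (S n)) - ln (INR n) <= / INR n.
Proof.
  intros Hn. assert (P := INR_pos n Hn). assert (Q := INR_S_pos n).
  rewrite <- ln_div by lra. split.
  - assert (I := Rinv_0_lt_compat _ P).
    assert (H : ln (INR n / INR (S n)) <= INR n / INR (S n) - 1).
    { rewrite <- (ln_exp (INR n / INR (S n) - 1)).
      apply ln_le; [now apply Rdiv_lt_0_compat|].
      assert (H := exp_ineq1_le (INR n / INR (S n) - 1)). lra. }
    rewrite ln_div in * by lra.
    replace (INR n / INR (S n) - 1) with (- / INR (S n)) in H
      by (rewrite S_INR in *; field; lra).
    lra.
  - rewrite <- (ln_exp (/ INR n)).
    apply ln_le; [now apply Rdiv_lt_0_compat|].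
    assert (H := exp_ineq1_le (/ INR n)).
    replace (INR (S n) / INR n) with (1 + / INR n)
      by (rewrite S_INR in *; field; lra).
    lra.
Qed.

Lemma harmonic_diff_bounds m d : (1 <= m)%nat ->
  ln (INR (S (m + d))) - ln (INR (S m)) <= harmonic (m + d) - harmonic m
  <= ln (INR (m + d)) - ln (INR m).
Proof.
  intros Hm. induction d as [|d IH].
  - rewrite Nat.add_0_r. lra.
  - rewrite Nat.add_succ_r, harmonic_S.
    assert (B1 := ln_succ_bounds (m + d) ltac:(lia)).
    assert (B2 := ln_succ_bounds (S (m + d)) ltac:(lia)). lra.
Qed.

(** Squeeze on H_(2x) - H_x with x = m + 1. The upper bound ln (2x) - ln x is exactly ln 2; the
    lower bound ln (2x + 1) - ln (x + 1) misses ln 2 by at most 1 / (2x + 1). *)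
Lemma is_lim_alt_harmonic_even :
  is_lim_seq (fun m => alt_harmonic (2 * S m) 1) (ln 2).
Proof.
  apply is_lim_seq_le_le with (fun m => ln 2 - / INR (S m)) (fun _ => ln 2).
  - intros m. rewrite alt_harmonic_even.
    assert (B := harmonic_diff_bounds (S m) (S m) ltac:(lia)).
    replace (S m + S m)%nat with (2 * S m)%nat in B by lia.
    assert (C := ln_succ_bounds (S (2 * S m)) ltac:(lia)).
    assert (P := INR_S_pos m).
    assert (E1 : ln (INR (2 * S m)) = ln 2 + ln (INR (S m))).
    { rewrite mult_INR. rewrite ln_mult; [reflexivity | simpl; lra | lra]. }
    assert (E2 : ln (INR (S (S (2 * S m)))) = ln 2 + ln (INR (S (S m)))).
    { replace (S (S (2 * S m))) with (2 * S (S m))%nat by lia.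
      rewrite mult_INR. rewrite ln_mult; [reflexivity | simpl; lra | apply INR_S_pos]. }
    assert (/ INR (S (2 * S m)) <= / INR (S m)).
    { apply Rinv_le_contravar; [lra | apply le_INR; lia]. }
    lra.
  - replace (Finite (ln 2)) with (Finite (ln 2 - 0)) by (f_equal; ring).
    apply is_lim_seq_minus'; [apply is_lim_seq_const | apply is_lim_inv_INR_S].
  - apply is_lim_seq_const.
Qed.

(** The rate precedes the convergence of the full sequence: the Leibniz bound on L_(n+d) - L_n
    passes to the limit along even indices, shifted so that they exceed n. *)
Lemma alt_harmonic_ln2 n : Rabs (alt_harmonic n 1 - ln 2) <= / INR (S n).
Proof.
  assert (H := is_lim_alt_harmonic_even).
  apply (is_lim_seq_incr_n _ n) in H.
  apply (is_lim_seq_le (fun m => Rabs (alt_harmonic n 1 - alt_harmonic (2 * S (m + n)) 1))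
    (fun _ => / INR (S n)) (Finite (Rabs (alt_harmonic n 1 - ln 2))) (Finite (/ INR (S n)))).
  - intros m. rewrite Rabs_minus_sym.
    replace (2 * S (m + n))%nat with (n + (2 + m + m + n))%nat by lia.
    apply alt_harmonic_cauchy.
  - apply (is_lim_seq_abs _ (Finite (alt_harmonic n 1 - ln 2))).
    apply is_lim_seq_minus'; [apply is_lim_seq_const | exact H].
  - apply is_lim_seq_const.
Qed.

Lemma is_lim_alt_harmonic : is_lim_seq (fun n => alt_harmonic n 1) (ln 2).
Proof.
  apply is_lim_seq_ext with (fun n => (alt_harmonic n 1 - ln 2) + ln 2).
  { intros; ring. }
  replace (Finite (ln 2)) with (Finite (0 + ln 2)) by (f_equal; ring).
  apply is_lim_seq_plus'; [|apply is_lim_seq_const].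
  apply is_lim_seq_abs_0.
  apply is_lim_seq_le_le with (fun _ => 0) (fun n => / INR (S n)).
  - intros n. split; [apply Rabs_pos | apply alt_harmonic_ln2].
  - apply is_lim_seq_const.
  - apply is_lim_inv_INR_S.
Qed.

Lemma Rabs_ln2_le : Rabs (ln 2) <= 1.
Proof.
  assert (H := alt_harmonic_ln2 0). rewrite alt_harmonic_0 in H.
  rewrite Rabs_minus_sym, Rminus_0_r in H. simpl in H. lra.
Qed.

(** The rate 1 / n beats the growth of H_n. This product is the boundary term of the Abel summation
    in [is_lim_sum1_alt_harmonic_shift]. *)
Lemma is_lim_alt_harmonic_mult_harmonic :
  is_lim_seq (fun n => (alt_harmonic n 1 - ln 2) * harmonic n) 0.
Proof.
  apply is_lim_seq_abs_0. apply is_lim_seq_incr_1.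
  apply is_lim_seq_le_le with (fun _ => 0) (fun n => harmonic (S n) / INR (S n)).
  - intros n. split; [apply Rabs_pos|].
    rewrite Rabs_mult, (Rabs_pos_eq (harmonic _)) by apply harmonic_nonneg.
    unfold Rdiv. rewrite Rmult_comm.
    apply Rmult_le_compat_l; [apply harmonic_nonneg|].
    eapply Rle_trans; [apply alt_harmonic_ln2|].
    apply Rinv_le_contravar; [apply INR_S_pos | apply le_INR; lia].
  - apply is_lim_seq_const.
  - apply (proj1 (is_lim_seq_incr_1 (fun n => harmonic n / INR n) 0)).
    apply is_lim_harmonic_div.
Qed.

Lemma is_lim_seq_eq u (a b : R) : is_lim_seq u a -> is_lim_seq u b -> a = b.
Proof.
  intros Ha Hb. apply is_lim_seq_unique in Ha. apply is_lim_seq_unique in Hb.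
  rewrite Ha in Hb. now injection Hb.
Qed.

(** The form in which Tannery's theorem is used: the fixed majorant also makes the limit series
    converge, so that its sum can be named. *)
Lemma tannery_total (f : nat -> nat -> R) (l : nat -> R) c :
  (forall M n, (1 <= n)%nat -> Rabs (f M n) <= c * (harmonic n / INR n ^ 2)) ->
  (forall n, (1 <= n)%nat -> is_lim_seq (fun M => f M n) (Finite (l n))) ->
  is_lim_seq (sum1 l) (total l) /\ is_lim_seq (fun M => sum1 (f M) M) (total l).
Proof.
  intros Hb Hl. destruct sum1_harmonic_sq_lim as [G HG].
  assert (HcG : is_lim_seq (sum1 (fun n => c * (harmonic n / INR n ^ 2))) (c * G)).
  { apply is_lim_seq_ext with (fun M => c * sum1 (fun n => harmonic n / INR n ^ 2) M).
    - intros. now rewrite sum1_scal.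
    - now apply (is_lim_seq_scal_l _ c (Finite G)). }
  assert (Hs : is_lim_seq (sum1 l) (total l)).
  { apply (sum1_converges l c). intros n Hn.
    apply (is_lim_seq_le (fun M => Rabs (f M n)) (fun _ => c * (harmonic n / INR n ^ 2))
             (Finite (Rabs (l n))) (Finite (c * (harmonic n / INR n ^ 2)))).
    - intros M. now apply Hb.
    - apply (is_lim_seq_abs _ (Finite (l n))). now apply Hl.
    - apply is_lim_seq_const. }
  split; [exact Hs|]. now apply (tannery f _ l (c * G) (total l) Hb HcG).
Qed.

Lemma is_lim_sum1_alt_tail n :
  is_lim_seq (sum1 (fun k => (-1) ^ k * / INR (n + k)))
    ((-1) ^ n * (alt_harmonic n 1 - ln 2)).
Proof.
  apply is_lim_seq_ext with
    (fun d => - (-1) ^ n * (alt_harmonic (d + n) 1 - alt_harmonic n 1)).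
  { intros d. now rewrite sum1_alt_tail, Nat.add_comm. }
  replace (Finite ((-1) ^ n * (alt_harmonic n 1 - ln 2)))
    with (Rbar_mult (Finite (- (-1) ^ n)) (Finite (ln 2 - alt_harmonic n 1)))
    by (simpl; f_equal; ring).
  apply is_lim_seq_scal_l.
  apply is_lim_seq_minus'; [|apply is_lim_seq_const].
  apply (proj1 (is_lim_seq_incr_n (fun d => alt_harmonic d 1) n (ln 2))).
  apply is_lim_alt_harmonic.
Qed.

(** Since H_n >= 1, terms of order 1 / n^2 fit under the common majorant. *)
Lemma inv_le_harmonic_sq n c x : (1 <= n)%nat ->
  x <= c / INR n ^ 2 -> 0 <= c -> x <= c * (harmonic n / INR n ^ 2).
Proof.
  intros Hn Hx Hc. assert (P := INR_pos n Hn). assert (Q := harmonic_ge_1 n Hn).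
  assert (I : 0 < / INR n ^ 2) by (apply Rinv_0_lt_compat, pow_lt; lra).
  unfold Rdiv in *. eapply Rle_trans; [exact Hx|]. rewrite <- Rmult_assoc.
  apply Rmult_le_compat_r; [lra | nra].
Qed.

(** Symmetrisation: 1 / (j (j + k)) + 1 / (k (j + k)) = 1 / (j k), so twice the sum over the square
    is L_M^2. *)
Lemma is_lim_sum1_alt_square :
  is_lim_seq (fun M => sum1 (fun j => (-1) ^ j * / INR j *
     sum1 (fun k => (-1) ^ k * / INR (j + k)) M) M) (ln 2 ^ 2 / 2).
Proof.
  apply is_lim_seq_ext with (fun M => / 2 * (alt_harmonic M 1 * alt_harmonic M 1)).
  - intros M. symmetry.
    set (T := fun j k => (-1) ^ j * / INR j * ((-1) ^ k * / INR (j + k))).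
    assert (E : sum1 (fun j => sum1 (T j) M) M = / 2 * (alt_harmonic M 1 * alt_harmonic M 1)).
    { enough (2 * sum1 (fun j => sum1 (T j) M) M = alt_harmonic M 1 * alt_harmonic M 1) by lra.
      replace (2 * sum1 (fun j => sum1 (T j) M) M)
        with (sum1 (fun j => sum1 (T j) M) M + sum1 (fun j => sum1 (fun i => T i j) M) M)
        by (rewrite <- (sum1_swap T); ring).
      rewrite <- sum1_plus.
      rewrite (sum1_ext _ (fun j => - alt_harmonic M 1 * ((-1) ^ j * / INR j ^ 1))).
      - rewrite sum1_scal, (alt_harmonic_sum1 M 1). ring.
      - intros j Hj. rewrite <- sum1_plus.
        rewrite (sum1_ext _ (fun k => (-1) ^ j * / INR j ^ 1 * ((-1) ^ k * / INR k ^ 1))).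
        + rewrite sum1_scal, (alt_harmonic_sum1 M 1). ring.
        + intros k Hk. unfold T. rewrite (Nat.add_comm k j), plus_INR.
          assert (P := INR_pos j ltac:(lia)). assert (Q := INR_pos k ltac:(lia)).
          field. lra. }
    rewrite <- E. apply sum1_ext. intros j _. unfold T. now rewrite sum1_scal.
  - replace (Finite (ln 2 ^ 2 / 2)) with (Rbar_mult (/ 2) (Finite (ln 2 * ln 2)))
      by (simpl; f_equal; field).
    apply is_lim_seq_scal_l. apply is_lim_seq_mult'; apply is_lim_alt_harmonic.
Qed.

(** The remainder L_j - ln 2 is (-1)^j times the sum over k of (-1)^k / (j + k). The series is thus
    the double sum of [is_lim_sum1_alt_square], with the inner sums completed by Tannery's
    theorem. *)
Lemma is_lim_sum1_alt_harmonic_remainder :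
  is_lim_seq (sum1 (fun j => (alt_harmonic j 1 - ln 2) / INR j)) (ln 2 ^ 2 / 2).
Proof.
  set (f := fun j => (alt_harmonic j 1 - ln 2) / INR j).
  assert (B : forall n x, (1 <= n)%nat -> Rabs x <= / INR (S n) ->
    Rabs (/ INR n * x) <= 1 * (harmonic n / INR n ^ 2)).
  { intros n x Hn Hx. apply inv_le_harmonic_sq; [exact Hn| |lra].
    assert (P := INR_pos n Hn). assert (I := Rinv_0_lt_compat _ P).
    rewrite Rabs_mult, (Rabs_pos_eq (/ INR n)) by lra.
    replace (1 / INR n ^ 2) with (/ INR n * / INR n) by (field; lra).
    apply Rmult_le_compat_l; [lra|]. eapply Rle_trans; [exact Hx|].
    apply Rinv_le_contravar; [lra | apply le_INR; lia]. }
  destruct (tannery_total (fun M j => (-1) ^ j * / INR j *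
     sum1 (fun k => (-1) ^ k * / INR (j + k)) M) f 1) as [C D].
  - intros M n Hn. rewrite !Rabs_mult, Rabs_pow_m1, Rmult_1_l, <- Rabs_mult.
    apply B; [exact Hn | apply sum1_alt_tail_bound].
  - intros n Hn.
    replace (Finite (f n)) with (Rbar_mult (Finite ((-1) ^ n * / INR n))
      (Finite ((-1) ^ n * (alt_harmonic n 1 - ln 2)))).
    + apply is_lim_seq_scal_l, is_lim_sum1_alt_tail.
    + simpl. f_equal. unfold f.
      transitivity ((-1) ^ n * (-1) ^ n * ((alt_harmonic n 1 - ln 2) / INR n)).
      * unfold Rdiv. ring.
      * rewrite pow_m1_sq. ring.
  - now rewrite (is_lim_seq_eq _ _ _ is_lim_sum1_alt_square D).
Qed.

(** * Alternating sums of harmonic numbers over n + k *)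

(** Minus the truncated star sum with arguments 1 and barred 1; its Euler sum is the quantity
    eliminated at the end. *)
Definition star_alt (n : nat) : R := sum1 (fun j => alt_harmonic j 1 / INR j) n.

Lemma star_alt_S n :
  star_alt (S n) = star_alt n + alt_harmonic (S n) 1 / INR (S n).
Proof. exact (sum1_S (fun j => alt_harmonic j 1 / INR j) n). Qed.

Lemma harmonic_pred k : (1 <= k)%nat -> harmonic (k - 1) = harmonic k - / INR k.
Proof.
  intros Hk. destruct k as [|k]; [lia|]. rewrite harmonic_S.
  replace (S k - 1)%nat with k by lia. ring.
Qed.

(** Abel summation, from H_k L_k - H_(k-1) L_(k-1) = H_(k-1) (L_k - L_(k-1)) + L_k / k. *)
Lemma sum1_alt_harmonic_pred M :
  sum1 (fun k => (-1) ^ k * harmonic (k - 1) * / INR k) M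
  = star_alt M - harmonic M * alt_harmonic M 1.
Proof.
  induction M as [|M IH].
  - rewrite harmonic_0. unfold star_alt. rewrite !sum1_0. ring.
  - rewrite sum1_S, IH, star_alt_S, harmonic_S, alt_harmonic_1_S.
    replace (S M - 1)%nat with M by lia. simpl pow. unfold Rdiv. ring.
Qed.

(** The closed form of (-1)^n U_n, where U_n is the sum over k of (-1)^k H_(k-1) / (n + k). *)
Definition star_limit (n : nat) : R :=
  ln 2 ^ 2 / 2 - ln 2 * alt_harmonic n 1 - ln 2 * harmonic n + star_alt n.

Lemma is_lim_alt_harmonic_inv n : (1 <= n)%nat ->
  is_lim_seq (sum1 (fun k => (-1) ^ k * / INR k * / INR (n + k)))
    (((-1) ^ n * (ln 2 - alt_harmonic n 1) - ln 2) / INR n).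
Proof.
  intros Hn. apply is_lim_seq_ext with
    (fun M => / INR n * (- alt_harmonic M 1 - sum1 (fun k => (-1) ^ k * / INR (n + k)) M)).
  - intros M. rewrite alt_harmonic_sum1, Ropp_involutive, <- sum1_minus, <- sum1_scal.
    apply sum1_ext. intros k Hk. rewrite plus_INR.
    assert (P := INR_pos n Hn). assert (Q := INR_pos k ltac:(lia)). field. lra.
  - replace (Finite (((-1) ^ n * (ln 2 - alt_harmonic n 1) - ln 2) / INR n))
      with (Rbar_mult (/ INR n) (Finite (- ln 2 - (-1) ^ n * (alt_harmonic n 1 - ln 2))))
      by (simpl; f_equal; unfold Rdiv; ring).
    apply is_lim_seq_scal_l, is_lim_seq_minus'; [|apply is_lim_sum1_alt_tail].
    apply (is_lim_seq_opp _ (ln 2)), is_lim_alt_harmonic.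
Qed.

(** Induction on n. Replacing k by k + 1 and using H_k = H_(k-1) + 1 / k gives U_(n+1) = - U_n - sum
    of (-1)^k / (k (n + 1 + k)). *)
Lemma is_lim_sum1_alt_harmonic_shift n :
  is_lim_seq (sum1 (fun k => (-1) ^ k * harmonic (k - 1) * / INR (n + k)))
    ((-1) ^ n * star_limit n).
Proof.
  induction n as [|n IH].
  (* For n = 0, Abel summation applies; adding and subtracting ln 2 H_M separates a convergent
     series from a boundary term that tends to 0. *)
  - apply is_lim_seq_ext with (fun M => sum1 (fun j => (alt_harmonic j 1 - ln 2) / INR j) M
      - (alt_harmonic M 1 - ln 2) * harmonic M).
    + intros M.
      change (sum1 (fun k => (-1) ^ k * harmonic (k - 1) * / INR (0 + k)) M)
        with (sum1 (fun k => (-1) ^ k * harmonic (k - 1) * / INR k) M).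
      rewrite sum1_alt_harmonic_pred. unfold star_alt.
      rewrite (sum1_ext _ (fun j => alt_harmonic j 1 / INR j - ln 2 * / INR j))
        by (intros; unfold Rdiv; ring).
      rewrite sum1_minus, sum1_scal.
      change (sum1 (fun j => / INR j) M) with (harmonic M). ring.
    + replace (Finite ((-1) ^ 0 * star_limit 0)) with (Finite (ln 2 ^ 2 / 2 - 0)).
      * apply is_lim_seq_minus'; [apply is_lim_sum1_alt_harmonic_remainder
                                 | apply is_lim_alt_harmonic_mult_harmonic].
      * unfold star_limit, star_alt. rewrite alt_harmonic_0, harmonic_0, sum1_0.
        f_equal. simpl. lra.
  (* The sum for n is taken up to [S M], since its first term, with H_0 = 0, disappears in the
     shift. *)
  - apply is_lim_seq_ext with (fun M =>
      - sum1 (fun k => (-1) ^ k * harmonic (k - 1) * / INR (n + k)) (S M)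
      - sum1 (fun k => (-1) ^ k * / INR k * / INR (S n + k)) M).
    + intros M. rewrite sum1_shift. replace (1 - 1)%nat with 0%nat by lia.
      rewrite harmonic_0.
      rewrite (sum1_ext _ (fun k => -1 * ((-1) ^ k * harmonic (k - 1) * / INR (S n + k)
        + (-1) ^ k * / INR k * / INR (S n + k)))).
      * rewrite sum1_scal, sum1_plus. ring.
      * intros k Hk. rewrite (harmonic_pred k) by lia.
        replace (n + S k)%nat with (S n + k)%nat by lia.
        replace (S k - 1)%nat with k by lia. simpl pow. ring.
    + replace (Finite ((-1) ^ S n * star_limit (S n))) with (Finite (
        - ((-1) ^ n * star_limit n)
        - ((-1) ^ S n * (ln 2 - alt_harmonic (S n) 1) - ln 2) / INR (S n))).
      * apply is_lim_seq_minus'; [|apply is_lim_alt_harmonic_inv; lia].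
        apply (is_lim_seq_opp _ (Finite ((-1) ^ n * star_limit n))).
        now apply is_lim_seq_incr_1 in IH.
      * f_equal. unfold star_limit. rewrite star_alt_S, harmonic_S, alt_harmonic_1_S.
        simpl pow. unfold Rdiv.
        assert (E := pow_m1_sq n). set (e := (-1) ^ n) in *.
        set (i := / INR (S n)).
        transitivity (- e * (ln 2 ^ 2 / 2 - ln 2 * alt_harmonic n 1 - ln 2 * harmonic n
          + star_alt n) + e * (ln 2 - alt_harmonic n 1 - e * i) * i + (e * e) * ln 2 * i);
        [rewrite E|]; unfold Rdiv; ring.
Qed.

(** Partial fractions in k reduce the sum to (U_0 - U_n) / n, and U_0 = (ln 2)^2 / 2. *)
Lemma is_lim_alt_harmonic_shift_inv n : (1 <= n)%nat ->
  is_lim_seq (sum1 (fun k => (-1) ^ k * harmonic (k - 1) * / INR k * / INR (n + k)))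
    ((ln 2 ^ 2 / 2 - (-1) ^ n * star_limit n) / INR n).
Proof.
  intros Hn. apply is_lim_seq_ext with (fun M => / INR n *
    (sum1 (fun k => (-1) ^ k * harmonic (k - 1) * / INR (0 + k)) M
     - sum1 (fun k => (-1) ^ k * harmonic (k - 1) * / INR (n + k)) M)).
  - intros M. rewrite <- sum1_minus, <- sum1_scal.
    apply sum1_ext. intros k Hk. rewrite Nat.add_0_l, plus_INR.
    assert (P := INR_pos n Hn). assert (Q := INR_pos k ltac:(lia)). field. lra.
  - replace (Finite ((ln 2 ^ 2 / 2 - (-1) ^ n * star_limit n) / INR n))
      with (Rbar_mult (/ INR n) (Finite ((-1) ^ 0 * star_limit 0 - (-1) ^ n * star_limit n))).
    + apply is_lim_seq_scal_l, is_lim_seq_minus'; apply is_lim_sum1_alt_harmonic_shift.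
    + unfold star_limit at 1, star_alt. rewrite alt_harmonic_0, harmonic_0, sum1_0.
      simpl. f_equal. unfold Rdiv. ring.
Qed.

(** * The kernel 1 / (j - n) *)

(* Since [/ 0 = 0], sums of [/ (INR k - INR n)] over all [k] silently omit [k = n]. *)
Lemma inv_diff_S k m : / (INR (S k) - INR (S m)) = / (INR k - INR m).
Proof. f_equal. rewrite !S_INR. ring. Qed.

(** At m = 0 both sides are 0 by the convention on [/ 0]; this lets the recursions below start at n
    = 0. *)
Lemma inv_diff_1_S m : / (INR 1 - INR (S m)) = - / INR m.
Proof.
  rewrite inv_diff_S, <- Rinv_opp. f_equal. simpl. ring.
Qed.

Lemma sum1_inv_sq_le M : sum1 (fun j => (/ INR j) ^ 2) M <= 2.
Proof.
  destruct M as [|M]; [rewrite sum1_0; lra|].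
  enough (sum1 (fun j => (/ INR j) ^ 2) (S M) <= 2 - / INR (S M)).
  { assert (P := Rinv_0_lt_compat _ (INR_S_pos M)). lra. }
  induction M as [|M IH].
  - rewrite sum1_S, sum1_0. simpl. lra.
  - rewrite sum1_S, (S_INR (S M)). assert (P := INR_S_pos M).
    set (x := INR (S M)) in *.
    assert (E : / x - / (x + 1) - (/ (x + 1)) ^ 2 = / (x * (x + 1) ^ 2)) by (field; lra).
    assert (0 < / (x * (x + 1) ^ 2)) by (apply Rinv_0_lt_compat; nra).
    lra.
Qed.

Lemma sum1_inv_diff_sq_le n M : sum1 (fun j => (/ (INR j - INR n)) ^ 2) M <= 4.
Proof.
  (* The added 1 / n^2 is the term j = 1 that appears on passing from n to n + 1, so the induction
     closes. The final 4 is 2 + 2, one 2 for each side of the diagonal. *)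
  enough (K : forall n M, sum1 (fun j => (/ (INR j - INR n)) ^ 2) M + (/ INR n) ^ 2
    <= 2 + sum1 (fun j => (/ INR j) ^ 2) n).
  { specialize (K n M). assert (B := sum1_inv_sq_le n).
    assert (S := pow2_ge_0 (/ INR n)). lra. }
  clear n M. induction n as [|n IH]; intros M.
  - rewrite (sum1_ext _ (fun j => (/ INR j) ^ 2))
      by (intros; simpl (INR 0); now rewrite Rminus_0_r).
    rewrite sum1_0. simpl (INR 0). rewrite Rinv_0.
    assert (B := sum1_inv_sq_le M). simpl pow in *. lra.
  - rewrite sum1_S. destruct M as [|M].
    + assert (N : 0 <= sum1 (fun j => (/ INR j) ^ 2) n)
        by (apply sum1_nonneg; intros; apply pow2_ge_0).
      rewrite sum1_0. lra.
    + rewrite sum1_shift, inv_diff_1_S.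
      rewrite (sum1_ext _ (fun j => (/ (INR j - INR n)) ^ 2))
        by (intros; now rewrite inv_diff_S).
      specialize (IH M). rewrite <- Rsqr_pow2, <- Rsqr_neg, Rsqr_pow2. lra.
Qed.

(** An alternating row sum of the discrete Hilbert kernel, whose diagonal term is 0. It is the
    coefficient of L_n / n^s in [convolution_finite]. *)
Definition alt_kernel (n M : nat) : R :=
  sum1 (fun j => (-1) ^ (n + j) * / (INR j - INR n)) M.

(** The summand depends only on j - n, because n + j and j - n have the same parity. Shifting both
    indices leaves just the new term j = 1. *)
Lemma alt_kernel_S n M :
  alt_kernel (S n) (S M) = alt_kernel n M - (-1) ^ n * / INR n.
Proof.
  unfold alt_kernel. rewrite sum1_shift, inv_diff_1_S.
  rewrite (sum1_ext _ (fun j => (-1) ^ (n + j) * / (INR j - INR n))).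
  - replace (S n + 1)%nat with (S (S n)) by lia. simpl pow. ring.
  - intros j _. rewrite inv_diff_S. replace (S n + S j)%nat with (S (S (n + j))) by lia.
    simpl pow. ring.
Qed.

Lemma alt_kernel_0 M : alt_kernel 0 M = - alt_harmonic M 1.
Proof.
  rewrite alt_harmonic_sum1, Ropp_involutive. apply sum1_ext. intros j _.
  simpl (INR 0). now rewrite Rminus_0_r, pow_1.
Qed.

Lemma alt_kernel_bound n M : Rabs (alt_kernel n M) <= 1 + harmonic n.
Proof.
  (* The sharper bound carries 1 / n on the left, which is exactly the cost of the next step of the
     recursion. *)
  enough (K : forall n M, Rabs (alt_kernel n M) + / INR n <= 1 + harmonic n).
  { specialize (K n M). enough (0 <= / INR n) by lra.
    destruct n; [simpl (INR 0); rewrite Rinv_0; lra|].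
    left. apply Rinv_0_lt_compat, INR_S_pos. }
  clear n M. induction n as [|n IH]; intros M.
  - rewrite alt_kernel_0, Rabs_Ropp, harmonic_0. simpl (INR 0). rewrite Rinv_0.
    assert (B := alt_harmonic_bound M 1). lra.
  - rewrite harmonic_S. destruct M as [|M].
    + unfold alt_kernel. rewrite sum1_0, Rabs_R0. assert (B := harmonic_nonneg n). lra.
    + rewrite alt_kernel_S. specialize (IH M).
      assert (T := Rabs_triang (alt_kernel n M) (- ((-1) ^ n * / INR n))).
      rewrite Rabs_Ropp, Rabs_mult, Rabs_pow_m1, Rmult_1_l in T.
      assert (N : Rabs (/ INR n) = / INR n).
      { apply Rabs_pos_eq. destruct n; [simpl (INR 0); rewrite Rinv_0; lra|].
        left. apply Rinv_0_lt_compat, INR_S_pos. }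
      unfold Rminus. lra.
Qed.

(** For n >= 1 the limit is L_(n-1) - ln 2. Written with L_n, the formula also holds at n = 0, where
    [/ INR 0] is 0. *)
Lemma is_lim_alt_kernel n :
  is_lim_seq (alt_kernel n) (alt_harmonic n 1 + (-1) ^ n * / INR n - ln 2).
Proof.
  induction n as [|n IH].
  - apply is_lim_seq_ext with (fun M => - alt_harmonic M 1).
    { intros M. now rewrite alt_kernel_0. }
    rewrite alt_harmonic_0. simpl (INR 0). rewrite Rinv_0.
    replace (Finite (0 + (-1) ^ 0 * 0 - ln 2)) with (Rbar_opp (ln 2))
      by (simpl; f_equal; ring).
    apply (is_lim_seq_opp _ (ln 2)), is_lim_alt_harmonic.
  - apply is_lim_seq_incr_1.
    apply is_lim_seq_ext with (fun M => alt_kernel n M - (-1) ^ n * / INR n).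
    { intros M. now rewrite alt_kernel_S. }
    replace (Finite (alt_harmonic (S n) 1 + (-1) ^ S n * / INR (S n) - ln 2)) with
      (Finite (alt_harmonic n 1 + (-1) ^ n * / INR n - ln 2 - (-1) ^ n * / INR n))
      by (f_equal; rewrite alt_harmonic_1_S; simpl pow; unfold Rdiv; ring).
    apply is_lim_seq_minus'; [exact IH | apply is_lim_seq_const].
Qed.

(** For 1 <= m <= M the kernel sum is H_(M-m) - H_(m-1); subtracting H_M removes the divergence and
    leaves - H_(m-1). *)
Lemma is_lim_sum1_inv_diff m :
  is_lim_seq (fun M => sum1 (fun k => / (INR k - INR m)) M - harmonic M)
    (/ INR m - harmonic m).
Proof.
  induction m as [|m IH].
  - apply is_lim_seq_ext with (fun _ => 0).
    + intros M. rewrite (sum1_ext _ (fun k => / INR k))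
        by (intros; simpl (INR 0); now rewrite Rminus_0_r).
      change (sum1 (fun k => / INR k) M) with (harmonic M). ring.
    + rewrite harmonic_0. simpl (INR 0). rewrite Rinv_0, Rminus_0_r.
      apply is_lim_seq_const.
  - apply is_lim_seq_incr_1.
    apply is_lim_seq_ext with
      (fun M => (sum1 (fun k => / (INR k - INR m)) M - harmonic M) - / INR m - / INR (S M)).
    + intros M. symmetry. rewrite sum1_shift, inv_diff_1_S, harmonic_S.
      rewrite (sum1_ext _ (fun k => / (INR k - INR m)) M)
        by (intros; now rewrite inv_diff_S).
      ring.
    + replace (Finite (/ INR (S m) - harmonic (S m)))
        with (Finite (/ INR m - harmonic m - / INR m - 0))
        by (f_equal; rewrite harmonic_S; ring).
      apply is_lim_seq_minus'; [|apply is_lim_inv_INR_S].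
      apply is_lim_seq_minus'; [exact IH | apply is_lim_seq_const].
Qed.

Lemma is_lim_sum1_inv_inv_diff m : (1 <= m)%nat ->
  is_lim_seq (sum1 (fun k => / INR k * / (INR k - INR m)))
    (/ INR m * (/ INR m - harmonic m) + / INR m ^ 2).
Proof.
  intros Hm. apply is_lim_seq_ext_loc with (fun M =>
    / INR m * (sum1 (fun k => / (INR k - INR m)) M - harmonic M) + / INR m ^ 2).
  (* Partial fractions fail only at k = m, where the left side is 0 and the right side is -1 / m^2;
     the added 1 / m^2 corrects this once M >= m. *)
  - exists m. intros M HM.
    rewrite <- (sum1_delta (fun _ => / INR m ^ 2) m M) by lia.
    change (harmonic M) with (sum1 (fun k => / INR k) M).
    rewrite <- sum1_minus, <- sum1_scal, <- sum1_plus.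
    apply sum1_ext. intros k Hk. assert (P := INR_pos m Hm).
    assert (Q := INR_pos k ltac:(lia)).
    destruct (Nat.eq_dec k m) as [->|N].
    + rewrite Rminus_diag, Rinv_0. field. lra.
    + apply not_INR in N. field. repeat split; lra.
  - apply is_lim_seq_plus'; [|apply is_lim_seq_const].
    apply (is_lim_seq_scal_l _ (/ INR m) (Finite (/ INR m - harmonic m))).
    apply is_lim_sum1_inv_diff.
Qed.

Lemma zeta_lim s : (2 <= s)%nat -> is_lim_seq (sum1 (fun n => / INR n ^ s)) (zeta s).
Proof.
  intros Hs. apply (sum1_converges (fun n => / INR n ^ s) 1). intros n Hn.
  apply inv_le_harmonic_sq; [exact Hn| |lra].
  assert (P := INR_ge_1 n Hn).
  rewrite Rabs_pos_eq by (left; apply Rinv_0_lt_compat, pow_lt; lra).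
  unfold Rdiv. rewrite Rmult_1_l.
  apply Rinv_le_contravar; [apply pow_lt; lra | now apply Rle_pow].
Qed.

(** Telescoping of squares: L_j^2 - L_(j-1)^2 = -2 (-1)^j L_j / j - 1 / j^2. *)
Lemma is_lim_sum1_alt_harmonic_alt :
  is_lim_seq (sum1 (fun j => (-1) ^ j * alt_harmonic j 1 * / INR j))
    (- ((ln 2 ^ 2 + zeta 2) / 2)).
Proof.
  apply is_lim_seq_ext with
    (fun M => - / 2 * (alt_harmonic M 1 * alt_harmonic M 1 + sum1 (fun n => / INR n ^ 2) M)).
  - intros M. induction M as [|M IH].
    + rewrite alt_harmonic_0, !sum1_0. ring.
    + rewrite !sum1_S, <- IH, alt_harmonic_1_S.
      assert (P := INR_S_pos M). assert (E := pow_m1_sq M).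
      rewrite <- (tech_pow_Rmult (-1) M).
      set (e := (-1) ^ M) in *. set (l := alt_harmonic M 1). set (x := INR (S M)) in *.
      set (z := sum1 _ M).
      transitivity (- / 2 * (l * l + z) - e * l / x - / 2 * (e * e) / x ^ 2 - / 2 / x ^ 2);
        [field; lra|].
      transitivity (- / 2 * (l * l + z) - e * l / x - (e * e) / x ^ 2);
        [rewrite E|]; field; lra.
  - replace (Finite (- ((ln 2 ^ 2 + zeta 2) / 2)))
      with (Rbar_mult (- / 2) (Finite (ln 2 * ln 2 + zeta 2)))
      by (simpl; f_equal; field).
    apply is_lim_seq_scal_l, is_lim_seq_plus'; [|apply zeta_lim; lia].
    apply is_lim_seq_mult'; apply is_lim_alt_harmonic.
Qed.

Definition alt_kernel_L (n M : nat) : R :=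
  sum1 (fun j => (-1) ^ (n + j) * alt_harmonic j 1 * / (INR j - INR n)) M.

(** Shifting both indices replaces L_j by L_j + (-1)^j / (j + 1). The two alternating signs cancel
    in the correction, which becomes a sum of 1 / (k (k - n - 1)). *)
Lemma alt_kernel_L_S n M : alt_kernel_L (S n) (S M)
  = alt_kernel_L n M + (-1) ^ n * sum1 (fun k => / INR k * / (INR k - INR (S n))) (S M).
Proof.
  unfold alt_kernel_L. rewrite !sum1_shift, inv_diff_1_S, Rmult_plus_distr_l, <- sum1_scal.
  rewrite (sum1_ext _ (fun j => (-1) ^ (n + j) * alt_harmonic j 1 * / (INR j - INR n)
    + (-1) ^ n * (/ INR (S j) * / (INR (S j) - INR (S n))))).
  - rewrite sum1_plus, alt_harmonic_1_S, alt_harmonic_0.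
    replace (S n + 1)%nat with (S (S n)) by lia. simpl pow. simpl (INR 1).
    unfold Rdiv. rewrite !Rinv_1. ring.
  - intros j _. rewrite inv_diff_S, alt_harmonic_1_S.
    replace (S n + S j)%nat with (S (S (n + j))) by lia. rewrite pow_add.
    assert (E := pow_m1_sq j). simpl pow. rewrite pow_add.
    transitivity ((-1) ^ n * (-1) ^ j * alt_harmonic j 1 * / (INR j - INR n)
      + (-1) ^ n * ((-1) ^ j * (-1) ^ j) * / INR (S j) * / (INR j - INR n));
      [unfold Rdiv | rewrite E]; ring.
Qed.

(** The limit is V_n. Its value at 0 is [is_lim_sum1_alt_harmonic_alt], and its increments come from
    [is_lim_sum1_inv_inv_diff]. *)
Lemma is_lim_alt_kernel_L n : is_lim_seq (alt_kernel_L n)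
  (star_alt n - harmonic n * alt_harmonic n 1 + alt_harmonic n 2 - (ln 2 ^ 2 + zeta 2) / 2).
Proof.
  induction n as [|n IH].
  - apply is_lim_seq_ext with (sum1 (fun j => (-1) ^ j * alt_harmonic j 1 * / INR j)).
    + intros M. apply sum1_ext. intros j _. simpl (INR 0). now rewrite Rminus_0_r.
    + unfold star_alt. rewrite harmonic_0, !alt_harmonic_0, sum1_0.
      replace (0 - 0 * 0 + 0 - (ln 2 ^ 2 + zeta 2) / 2)
        with (- ((ln 2 ^ 2 + zeta 2) / 2)) by ring.
      apply is_lim_sum1_alt_harmonic_alt.
  - apply is_lim_seq_incr_1.
    apply is_lim_seq_ext with (fun M => alt_kernel_L n M
      + (-1) ^ n * sum1 (fun k => / INR k * / (INR k - INR (S n))) (S M)).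
    { intros M. now rewrite alt_kernel_L_S. }
    match goal with |- is_lim_seq _ ?l => replace l with (Finite
      (star_alt n - harmonic n * alt_harmonic n 1 + alt_harmonic n 2 - (ln 2 ^ 2 + zeta 2) / 2
       + (-1) ^ n * (/ INR (S n) * (/ INR (S n) - harmonic (S n)) + / INR (S n) ^ 2))) end.
    + apply is_lim_seq_plus'; [exact IH|].
      apply (is_lim_seq_scal_l _ ((-1) ^ n) (Finite (/ INR (S n)
        * (/ INR (S n) - harmonic (S n)) + / INR (S n) ^ 2))).
      apply (proj1 (is_lim_seq_incr_1 (sum1 (fun k => / INR k * / (INR k - INR (S n)))) _)).
      apply is_lim_sum1_inv_inv_diff. lia.
    + f_equal. rewrite star_alt_S, harmonic_S, alt_harmonic_1_S, (alt_harmonic_S n 2).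
      assert (P := INR_S_pos n). field. lra.
Qed.

(** Writing L_j = ln 2 + (L_j - ln 2) gives ln 2 times [alt_kernel], at most 1 + H_n, plus a sum
    bounded absolutely through |L_j - ln 2| <= 1 / j. The latter is at most (2 + 4) / 2 = 3. *)
Lemma alt_kernel_L_bound n M : (1 <= n)%nat ->
  Rabs (alt_kernel_L n M) <= 4 + harmonic n.
Proof.
  intros Hn.
  replace (alt_kernel_L n M) with (ln 2 * alt_kernel n M
    + sum1 (fun j => (-1) ^ (n + j) * (alt_harmonic j 1 - ln 2) * / (INR j - INR n)) M).
  2:{ unfold alt_kernel, alt_kernel_L. rewrite <- sum1_scal, <- sum1_plus.
      apply sum1_ext. intros; ring. }
  eapply Rle_trans; [apply Rabs_triang|].
  assert (B1 : Rabs (ln 2 * alt_kernel n M) <= 1 + harmonic n).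
  { rewrite Rabs_mult. assert (A := alt_kernel_bound n M). assert (C := Rabs_ln2_le).
    assert (Rabs (alt_kernel n M) >= 0) by (apply Rle_ge, Rabs_pos). nra. }
  enough (Rabs (sum1 (fun j => (-1) ^ (n + j) * (alt_harmonic j 1 - ln 2)
    * / (INR j - INR n)) M) <= 3) by lra.
  eapply Rle_trans; [apply sum1_abs|].
  (* AM-GM: [|x y| <= (x^2 + y^2) / 2] *)
  eapply Rle_trans with (sum1 (fun j => / 2 * ((/ INR j) ^ 2 + (/ (INR j - INR n)) ^ 2)) M).
  - apply sum1_le. intros j Hj. rewrite !Rabs_mult, Rabs_pow_m1, Rmult_1_l.
    assert (A : Rabs (alt_harmonic j 1 - ln 2) <= / INR j).
    { eapply Rle_trans; [apply alt_harmonic_ln2|].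
      apply Rinv_le_contravar; [now apply INR_pos | apply le_INR; lia]. }
    set (x := Rabs (alt_harmonic j 1 - ln 2)) in *.
    rewrite <- (pow2_abs (/ (INR j - INR n))).
    set (y := Rabs (/ (INR j - INR n))).
    assert (0 <= y) by apply Rabs_pos. assert (0 <= x) by apply Rabs_pos.
    assert (0 <= (/ INR j - y) ^ 2) by apply pow2_ge_0. nra.
  - rewrite sum1_scal, sum1_plus.
    assert (A1 := sum1_inv_sq_le M). assert (A2 := sum1_inv_diff_sq_le n M). lra.
Qed.

(** * Linear Euler sums *)

Definition euler (f : nat -> R) (s : nat) : R := total (fun n => f n * / INR n ^ s).

(** The growth class whose Euler sums with exponent s >= 2 lie under a multiple of H_n / n^2; its
    closure properties justify splitting these sums. *)
Definition dominated (f : nat -> R) : Prop :=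
  exists c, forall n, (1 <= n)%nat -> Rabs (f n) <= c * harmonic n.

Lemma dominated_bounded f : (forall n, Rabs (f n) <= 1) -> dominated f.
Proof.
  intros H. exists 1. intros n Hn. specialize (H n).
  assert (B := harmonic_ge_1 n Hn). lra.
Qed.

Lemma dominated_plus f g :
  dominated f -> dominated g -> dominated (fun n => f n + g n).
Proof.
  intros [c Hc] [d Hd]. exists (c + d). intros n Hn.
  specialize (Hc n Hn). specialize (Hd n Hn).
  eapply Rle_trans; [apply Rabs_triang | lra].
Qed.

Lemma dominated_mult f g : (forall n, Rabs (f n) <= 1) -> dominated g ->
  dominated (fun n => f n * g n).
Proof.
  intros H [c Hc]. exists c. intros n Hn. specialize (H n). specialize (Hc n Hn).
  rewrite Rabs_mult. assert (0 <= Rabs (g n)) by apply Rabs_pos. nra.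
Qed.

Lemma dominated_scal a f : dominated f -> dominated (fun n => a * f n).
Proof.
  intros [c Hc]. exists (Rabs a * c). intros n Hn. specialize (Hc n Hn).
  rewrite Rabs_mult, Rmult_assoc. apply Rmult_le_compat_l; [apply Rabs_pos | exact Hc].
Qed.

Lemma dominated_harmonic : dominated harmonic.
Proof.
  exists 1. intros n _. rewrite Rabs_pos_eq by apply harmonic_nonneg. lra.
Qed.

Lemma dominated_star_alt : dominated star_alt.
Proof.
  exists 1. intros n _. eapply Rle_trans; [apply sum1_abs|].
  rewrite Rmult_1_l. apply sum1_le. intros k Hk.
  assert (P := Rinv_0_lt_compat _ (INR_pos k Hk)).
  assert (B := alt_harmonic_bound k 1).
  unfold Rdiv. rewrite Rabs_mult, (Rabs_pos_eq (/ INR k)) by lra. nra.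
Qed.

Lemma inv_pow_le n s : (1 <= n)%nat -> (2 <= s)%nat -> 0 < / INR n ^ s <= / INR n ^ 2.
Proof.
  intros Hn Hs. assert (P := INR_ge_1 n Hn). split.
  - apply Rinv_0_lt_compat, pow_lt. lra.
  - apply Rinv_le_contravar; [apply pow_lt; lra | now apply Rle_pow].
Qed.

Lemma mult_inv_pow_bound x c n s : (1 <= n)%nat -> (2 <= s)%nat ->
  Rabs x <= c * harmonic n -> Rabs (x * / INR n ^ s) <= c * (harmonic n / INR n ^ 2).
Proof.
  intros Hn Hs Hx. destruct (inv_pow_le n s Hn Hs) as [P Q].
  rewrite Rabs_mult, (Rabs_pos_eq (/ INR n ^ s)) by lra.
  unfold Rdiv. rewrite <- Rmult_assoc.
  apply Rmult_le_compat; [apply Rabs_pos | lra | exact Hx | exact Q].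
Qed.

Lemma euler_lim f s : (2 <= s)%nat -> dominated f ->
  is_lim_seq (sum1 (fun n => f n * / INR n ^ s)) (euler f s).
Proof.
  intros Hs [c Hc]. apply (sum1_converges (fun n => f n * / INR n ^ s) c).
  intros n Hn. apply mult_inv_pow_bound; auto.
Qed.

Lemma total_ext f g : (forall n, (1 <= n)%nat -> f n = g n) -> total f = total g.
Proof. intros E. apply Series_ext. intros n. apply E. lia. Qed.

Lemma euler_ext f g s : (forall n, (1 <= n)%nat -> f n = g n) -> euler f s = euler g s.
Proof. intros E. apply total_ext. intros n Hn. now rewrite E. Qed.

Lemma euler_scal a f s : euler (fun n => a * f n) s = a * euler f s.
Proof.
  unfold euler, total. rewrite <- Series_scal_l. apply Series_ext. intros n. ring.
Qed.

Lemma euler_plus f g s : (2 <= s)%nat -> dominated f -> dominated g ->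
  euler (fun n => f n + g n) s = euler f s + euler g s.
Proof.
  intros Hs Hf Hg. apply (total_unique (fun n => (f n + g n) * / INR n ^ s)).
  apply is_lim_seq_ext with (fun M => sum1 (fun n => f n * / INR n ^ s) M
    + sum1 (fun n => g n * / INR n ^ s) M).
  - intros M. rewrite <- sum1_plus. apply sum1_ext. intros; ring.
  - apply is_lim_seq_plus'; now apply euler_lim.
Qed.

Lemma euler_inv_INR f s : euler (fun n => f n * / INR n) s = euler f (S s).
Proof.
  apply total_ext. intros n Hn. assert (P := INR_pos n Hn).
  simpl pow. rewrite Rinv_mult. ring.
Qed.

Lemma zeta_euler s : zeta s = euler (fun _ => 1) s.
Proof. apply Series_ext. intros n. now rewrite Rmult_1_l. Qed.

Lemma zeta_bar_euler s : zeta_bar s = euler (fun n => - (-1) ^ n) s.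
Proof. apply Series_ext. intros n. simpl pow. unfold Rdiv. ring. Qed.

(** * Zeta-star values as Euler sums *)

Lemma star_sum_plain_1 n : star_sum [Plain 1] n = harmonic n.
Proof.
  apply sum1_ext. intros k _. simpl star_sum. unfold zarg_term.
  rewrite pow_1. ring.
Qed.

(** A barred argument carries (-1)^n while L_n starts with a plus sign, whence the minus signs from
    here on. *)
Lemma star_sum_bar s n : star_sum [Bar s] n = - alt_harmonic n s.
Proof.
  rewrite alt_harmonic_sum1, Ropp_involutive.
  apply sum1_ext. intros k _. simpl star_sum. unfold zarg_term, Rdiv. ring.
Qed.

Lemma zeta_star_plain_plain s : zeta_star [Plain s; Plain 1] = euler harmonic s.
Proof.
  apply Series_ext. intros n. rewrite star_sum_plain_1. unfold zarg_term. ring.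
Qed.

Lemma zeta_star_bar_plain s :
  zeta_star [Bar s; Plain 1] = euler (fun n => (-1) ^ n * harmonic n) s.
Proof.
  apply Series_ext. intros n. rewrite star_sum_plain_1. unfold zarg_term, Rdiv. ring.
Qed.

Lemma zeta_star_plain_bar s t :
  zeta_star [Plain s; Bar t] = - euler (fun n => alt_harmonic n t) s.
Proof.
  replace (- euler (fun n => alt_harmonic n t) s)
    with (-1 * euler (fun n => alt_harmonic n t) s) by ring.
  rewrite <- euler_scal. apply Series_ext. intros n. rewrite star_sum_bar.
  unfold zarg_term. ring.
Qed.

Lemma zeta_star_bar_bar s :
  zeta_star [Bar s; Bar 1] = - euler (fun n => (-1) ^ n * alt_harmonic n 1) s.
Proof.
  replace (- euler (fun n => (-1) ^ n * alt_harmonic n 1) s)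
    with (-1 * euler (fun n => (-1) ^ n * alt_harmonic n 1) s) by ring.
  rewrite <- euler_scal. apply Series_ext. intros n. rewrite star_sum_bar.
  unfold zarg_term, Rdiv. ring.
Qed.

Lemma Rabs_pow_m1_le n : Rabs ((-1) ^ n) <= 1.
Proof. rewrite Rabs_pow_m1. lra. Qed.

Lemma dominated_1 : dominated (fun _ => 1).
Proof. apply dominated_bounded. intros _. rewrite Rabs_R1. lra. Qed.

Lemma dominated_alt_harmonic k : dominated (fun n => alt_harmonic n k).
Proof. apply dominated_bounded. intros n. apply alt_harmonic_bound. Qed.

Lemma dominated_harmonic_alt_harmonic :
  dominated (fun n => harmonic n * alt_harmonic n 1).
Proof.
  destruct (dominated_mult (fun n => alt_harmonic n 1) harmonic) as [d Hd].
  - intros n. apply alt_harmonic_bound.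
  - apply dominated_harmonic.
  - exists d. intros n Hn. rewrite Rmult_comm. now apply Hd.
Qed.

Lemma zeta_bar_lim s : (1 <= s)%nat ->
  is_lim_seq (sum1 (fun n => - (-1) ^ n * / INR n ^ s)) (zeta_bar s).
Proof.
  intros Hs. rewrite zeta_bar_euler.
  (* For s = 1 the series converges only conditionally and its limit ln 2 is supplied directly. *)
  destruct (Nat.eq_dec s 1) as [->|N].
  - assert (H : is_lim_seq (sum1 (fun n => - (-1) ^ n * / INR n ^ 1)) (ln 2)).
    { apply is_lim_seq_ext with (fun M => alt_harmonic M 1).
      - intros M. rewrite alt_harmonic_sum1.
        rewrite (sum1_ext (fun n => - (-1) ^ n * / INR n ^ 1)
          (fun n => -1 * ((-1) ^ n * / INR n ^ 1))) by (intros; ring).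
        rewrite sum1_scal. ring.
      - apply is_lim_alt_harmonic. }
    unfold euler. now rewrite (total_unique _ _ H).
  - apply (euler_lim (fun n => - (-1) ^ n)); [lia|].
    apply dominated_bounded. intros n. rewrite Rabs_Ropp. apply Rabs_pow_m1_le.
Qed.

Lemma zeta_star_bar_bar_lim s : (1 <= s)%nat ->
  is_lim_seq (sum1 (fun n => - ((-1) ^ n * alt_harmonic n 1 * / INR n ^ s)))
    (zeta_star [Bar s; Bar 1]).
Proof.
  intros Hs. rewrite zeta_star_bar_bar.
  apply is_lim_seq_ext with
    (fun M => - sum1 (fun n => (-1) ^ n * alt_harmonic n 1 * / INR n ^ s) M).
  { intros M. replace (- sum1 (fun n => (-1) ^ n * alt_harmonic n 1 * / INR n ^ s) M)
      with (-1 * sum1 (fun n => (-1) ^ n * alt_harmonic n 1 * / INR n ^ s) M) by ring.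
    rewrite <- sum1_scal. apply sum1_ext. intros; ring. }
  apply (is_lim_seq_opp _ (Finite (euler (fun n => (-1) ^ n * alt_harmonic n 1) s))).
  (* The case s = 1 escapes the majorant; its convergence comes from the telescoping of L_j^2. *)
  destruct (Nat.eq_dec s 1) as [->|N].
  - assert (H : is_lim_seq (sum1 (fun n => (-1) ^ n * alt_harmonic n 1 * / INR n ^ 1))
      (- ((ln 2 ^ 2 + zeta 2) / 2))).
    { apply is_lim_seq_ext with (sum1 (fun j => (-1) ^ j * alt_harmonic j 1 * / INR j)).
      - intros M. apply sum1_ext. intros. now rewrite pow_1.
      - apply is_lim_sum1_alt_harmonic_alt. }
    unfold euler. now rewrite (total_unique _ _ H).
  - apply (euler_lim (fun n => (-1) ^ n * alt_harmonic n 1)); [lia|].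
    apply dominated_mult; [apply Rabs_pow_m1_le | apply dominated_alt_harmonic].
Qed.

(** * The convolution on finite squares *)

Lemma sum1_mult f g M N :
  sum1 f M * sum1 g N = sum1 (fun k => sum1 (fun m => f k * g m) N) M.
Proof.
  rewrite Rmult_comm, <- sum1_scal. apply sum1_ext. intros k _.
  rewrite sum1_scal. ring.
Qed.

(** The finite geometric sum in division-free form. It is applied with a = 1 / k, b = 1 / m and d =
    m - k. *)
Lemma geometric_diff a b d s : d * a * b = a - b ->
  d * sum1 (fun i => a ^ i * b ^ (S s - i)) s = a ^ s - b ^ s.
Proof.
  intros E. induction s as [|s IH].
  - rewrite sum1_0. simpl. ring.
  - rewrite sum1_S.
    rewrite (sum1_ext _ (fun i => b * (a ^ i * b ^ (S s - i)))).
    + rewrite sum1_scal. replace (S (S s) - S s)%nat with 1%nat by lia.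
      transitivity (b * (d * sum1 (fun i => a ^ i * b ^ (S s - i)) s)
        + a ^ s * (d * a * b)); [simpl pow; ring|].
      rewrite IH, E. simpl pow. ring.
    + intros i Hi. replace (S (S s) - i)%nat with (S (S s - i)) by lia. simpl pow. ring.
Qed.

Lemma geometric_diag a s : sum1 (fun i => a ^ i * a ^ (S s - i)) s = INR s * a ^ S s.
Proof.
  rewrite (sum1_ext _ (fun _ => a ^ S s)).
  - apply sum1_const.
  - intros i Hi. rewrite <- pow_add. f_equal. lia.
Qed.

Lemma sum1_inv_pow_inv_pow k m s : (1 <= k)%nat -> (1 <= m)%nat ->
  sum1 (fun i => / INR k ^ i * / INR m ^ (S s - i)) s
  = (/ INR k ^ s - / INR m ^ s) * / (INR m - INR k)
    + (if Nat.eq_dec m k then INR s * / INR k ^ S s else 0).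
Proof.
  intros Hk Hm. assert (P := INR_pos k Hk). assert (Q := INR_pos m Hm).
  rewrite (sum1_ext _ (fun i => (/ INR k) ^ i * (/ INR m) ^ (S s - i)))
    by (intros; now rewrite !pow_inv).
  rewrite <- !pow_inv. destruct (Nat.eq_dec m k) as [->|N].
  - rewrite geometric_diag, !Rminus_diag. ring.
  - apply not_INR in N.
    rewrite <- (geometric_diff _ _ (INR m - INR k)) by (field; lra).
    field. lra.
Qed.

Lemma convolution_finite s M :
  sum1 (fun i => sum1 (fun k => - ((-1) ^ k * alt_harmonic k 1 * / INR k ^ i)) M
    * sum1 (fun m => - (-1) ^ m * / INR m ^ (S s - i)) M) s
  - INR s * sum1 (fun k => alt_harmonic k 1 * / INR k ^ S s) M
  = sum1 (fun n => (alt_harmonic n 1 * alt_kernel n M + alt_kernel_L n M) * / INR n ^ s) M.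
Proof.
  (* The weight of the pair (k, m); the minus signs of the two factors cancel. *)
  set (e := fun k m : nat => (-1) ^ k * (-1) ^ m * alt_harmonic k 1).
  rewrite (sum1_ext _ (fun i => sum1 (fun k => sum1 (fun m =>
    e k m * (/ INR k ^ i * / INR m ^ (S s - i))) M) M)).
  2:{ intros i _. rewrite sum1_mult. apply sum1_ext. intros k _. apply sum1_ext.
      intros m _. unfold e. ring. }
  rewrite sum1_swap.
  rewrite (sum1_ext _ (fun k => sum1 (fun m => e k m * / INR k ^ s * / (INR m - INR k)) M
    + sum1 (fun m => e k m * / INR m ^ s * / (INR k - INR m)) M
    + INR s * (alt_harmonic k 1 * / INR k ^ S s))).
  - rewrite !sum1_plus, sum1_scal.
    (* After this swap both pieces have an outer factor n^(-s). In one, L sits at the outer index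
       and yields [alt_kernel]; in the other it sits at the inner index and yields
       [alt_kernel_L]. *)
    rewrite (sum1_swap (fun k m => e k m * / INR m ^ s * / (INR k - INR m))).
    unfold Rminus at 1. rewrite Rplus_assoc, Rplus_opp_r, Rplus_0_r, <- sum1_plus.
    apply sum1_ext. intros n Hn. unfold alt_kernel, alt_kernel_L.
    rewrite <- sum1_scal, <- !sum1_plus, (Rmult_comm _ (/ INR n ^ s)), <- sum1_scal.
    apply sum1_ext. intros j _. unfold e. rewrite pow_add. ring.
  - intros k Hk. rewrite sum1_swap.
    replace (INR s * (alt_harmonic k 1 * / INR k ^ S s)) with
      (sum1 (fun m => if Nat.eq_dec m k then INR s * (alt_harmonic k 1 * / INR k ^ S s)
                      else 0) M)
      by (now apply (sum1_delta (fun _ => INR s * (alt_harmonic k 1 * / INR k ^ S s)))).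
    rewrite <- !sum1_plus. apply sum1_ext. intros m Hm.
    rewrite sum1_scal, sum1_inv_pow_inv_pow by lia.
    replace (/ (INR k - INR m)) with (- / (INR m - INR k))
      by (rewrite <- Rinv_opp; f_equal; ring).
    (* On the diagonal the kernel terms vanish, and the weight [e k k] is L_k. *)
    destruct (Nat.eq_dec m k) as [->|N]; [|ring].
    unfold e. rewrite !Rminus_diag, !Rinv_0, !pow_m1_sq. ring.
Qed.

(** * The two double sums *)

Lemma convolution_limit s : (2 <= s)%nat ->
  sum1 (fun i => zeta_star [Bar i; Bar 1] * zeta_bar (S s - i)) s
  + INR s * zeta_star [Plain (S s); Bar 1]
  = total (fun n => (alt_harmonic n 1 * (alt_harmonic n 1 + (-1) ^ n * / INR n - ln 2)
      + (star_alt n - harmonic n * alt_harmonic n 1 + alt_harmonic n 2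
         - (ln 2 ^ 2 + zeta 2) / 2)) * / INR n ^ s).
Proof.
  intros Hs.
  (* The constant 7 arises from (1 + H_n) + (4 + H_n) <= 7 H_n. *)
  destruct (tannery_total
    (fun M n => (alt_harmonic n 1 * alt_kernel n M + alt_kernel_L n M) * / INR n ^ s)
    (fun n => (alt_harmonic n 1 * (alt_harmonic n 1 + (-1) ^ n * / INR n - ln 2)
      + (star_alt n - harmonic n * alt_harmonic n 1 + alt_harmonic n 2
         - (ln 2 ^ 2 + zeta 2) / 2)) * / INR n ^ s) 7) as [_ H].
  - intros M n Hn. apply mult_inv_pow_bound; [exact Hn | exact Hs|].
    eapply Rle_trans; [apply Rabs_triang|]. rewrite Rabs_mult.
    assert (B1 := alt_harmonic_bound n 1). assert (B2 := alt_kernel_bound n M).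
    assert (B3 := alt_kernel_L_bound n M Hn). assert (B4 := harmonic_ge_1 n Hn).
    assert (0 <= Rabs (alt_kernel n M)) by apply Rabs_pos. nra.
  - intros n Hn. apply (is_lim_seq_mult' _ _ _ (/ INR n ^ s)); [|apply is_lim_seq_const].
    apply is_lim_seq_plus'; [|apply is_lim_alt_kernel_L].
    apply (is_lim_seq_scal_l _ _ (Finite (alt_harmonic n 1 + (-1) ^ n * / INR n - ln 2))).
    apply is_lim_alt_kernel.
  - eapply is_lim_seq_eq; [|exact H].
    eapply is_lim_seq_ext; [intros M; apply convolution_finite|].
    rewrite zeta_star_plain_bar, <- Ropp_mult_distr_r. apply is_lim_seq_minus'.
    + apply (is_lim_sum1_finite (fun M i =>
        sum1 (fun k => - ((-1) ^ k * alt_harmonic k 1 * / INR k ^ i)) M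
        * sum1 (fun m => - (-1) ^ m * / INR m ^ (S s - i)) M)).
      intros i Hi. apply is_lim_seq_mult'.
      * apply zeta_star_bar_bar_lim. lia.
      * apply zeta_bar_lim. lia.
    + apply (is_lim_seq_scal_l _ _ (Finite (euler (fun n => alt_harmonic n 1) (S s)))).
      apply (euler_lim (fun n => alt_harmonic n 1));
        [lia | apply dominated_alt_harmonic].
Qed.

(** The limit is split into Euler sums; the part (-1)^n L_n / n raises the exponent and gives the
    zeta-star value at [S s]. *)
Lemma convolution_identity s : (2 <= s)%nat ->
  sum1 (fun i => zeta_star [Bar i; Bar 1] * zeta_bar (S s - i)) s
  + INR s * zeta_star [Plain (S s); Bar 1]
  = euler (fun n => alt_harmonic n 1 ^ 2) s - zeta_star [Bar (S s); Bar 1]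
    + ln 2 * zeta_star [Plain s; Bar 1] + euler star_alt s
    - euler (fun n => harmonic n * alt_harmonic n 1) s
    - zeta_star [Plain s; Bar 2] - (ln 2 ^ 2 + zeta 2) / 2 * zeta s.
Proof.
  intros Hs. rewrite convolution_limit by exact Hs.
  rewrite zeta_star_bar_bar, !zeta_star_plain_bar, (zeta_euler s), <- euler_inv_INR.
  set (c := (ln 2 ^ 2 + zeta 2) / 2).
  assert (D1 := dominated_alt_harmonic 1). assert (D2 := dominated_alt_harmonic 2).
  assert (DHL := dominated_harmonic_alt_harmonic).
  assert (DLL : dominated (fun n => alt_harmonic n 1 ^ 2)).
  { apply dominated_bounded. intros n. assert (B := alt_harmonic_bound n 1).
    rewrite <- RPow_abs. assert (0 <= Rabs (alt_harmonic n 1)) by apply Rabs_pos. nra. }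
  assert (DBL : dominated (fun n => (-1) ^ n * alt_harmonic n 1 * / INR n)).
  { destruct (dominated_mult (fun n => (-1) ^ n * / INR n) (fun n => alt_harmonic n 1))
      as [d Hd].
    - intros n. rewrite Rabs_mult, Rabs_pow_m1, Rmult_1_l.
      destruct n as [|n]; [simpl (INR 0); rewrite Rinv_0, Rabs_R0; lra|].
      assert (I := Rinv_0_lt_compat _ (INR_S_pos n)). rewrite Rabs_pos_eq by lra.
      rewrite <- Rinv_1. apply Rinv_le_contravar; [lra | apply INR_ge_1; lia].
    - exact D1.
    - exists d. intros n Hn. rewrite Rmult_assoc, (Rmult_comm (alt_harmonic n 1)),
        <- Rmult_assoc. now apply Hd. }
  transitivity (euler (fun n => alt_harmonic n 1 ^ 2
    + ((-1) ^ n * alt_harmonic n 1 * / INR n + ((- ln 2) * alt_harmonic n 1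
    + (star_alt n + (-1 * (harmonic n * alt_harmonic n 1)
    + (alt_harmonic n 2 + (- c) * 1)))))) s).
  - apply total_ext. intros n Hn. ring.
  - repeat rewrite euler_plus; try exact Hs;
      repeat first [ assumption | apply dominated_star_alt | apply dominated_1
                   | apply dominated_scal | apply dominated_plus ].
    rewrite !euler_scal. ring.
Qed.

(** * The first double sum, in both orders *)

Lemma harmonic_ratio_decr k : (1 <= k)%nat ->
  harmonic (S k) * / INR (S (S k)) <= harmonic k * / INR (S k).
Proof.
  intros Hk. rewrite harmonic_S, (S_INR (S k)). assert (P := INR_S_pos k).
  assert (B := harmonic_ge_1 k Hk). set (x := INR (S k)) in *. set (h := harmonic k) in *.
  assert (E : h * / x - (h + / x) * / (x + 1) = (h - 1) * / (x * (x + 1)))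
    by (field; lra).
  assert (0 < / (x * (x + 1))) by (apply Rinv_0_lt_compat; nra). nra.
Qed.

(** The term k = 1 vanishes. After a shift the factors H_k / (k + 1) and 1 / (n + k + 1) both
    decrease, so the Leibniz bound gives 1 / (2 (n + 2)), below 1 / (n + 1). *)
Lemma alt_harmonic_shift_inv_bound n M :
  Rabs (sum1 (fun k => (-1) ^ k * harmonic (k - 1) * / INR k * / INR (n + k)) M)
  <= / INR (S n).
Proof.
  assert (I : forall j, 0 < / INR (S j)) by (intros j; apply Rinv_0_lt_compat, INR_S_pos).
  destruct M as [|M]; [rewrite sum1_0, Rabs_R0; specialize (I n); lra|].
  rewrite sum1_shift. replace (1 - 1)%nat with 0%nat by lia. rewrite harmonic_0.
  rewrite (sum1_ext _
    (fun k => -1 * ((-1) ^ k * (harmonic k * / INR (S k) * / INR (n + S k))))).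
  2:{ intros k _. replace (S k - 1)%nat with k by lia. simpl pow. ring. }
  rewrite sum1_scal.
  set (T := sum1 (fun k => (-1) ^ k * (harmonic k * / INR (S k) * / INR (n + S k))) M).
  replace (_ + -1 * T) with (- T) by ring. rewrite Rabs_Ropp. unfold T.
  assert (D : forall k, / INR (n + S (S k)) <= / INR (n + S k)).
  { intros k. apply Rinv_le_contravar; [apply INR_pos; lia | apply le_INR; lia]. }
  assert (J : forall k, 0 < / INR (n + S k)).
  { intros k. apply Rinv_0_lt_compat, INR_pos. lia. }
  eapply Rle_trans.
  - apply (leibniz_bound (fun k => harmonic k * / INR (S k) * / INR (n + S k))).
    + intros k Hk. assert (B := harmonic_ratio_decr k Hk).
      assert (N := harmonic_nonneg (S k)). assert (N' := harmonic_nonneg k).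
      specialize (D k). assert (J1 := J (S k)). assert (J0 := J k).
      assert (0 <= harmonic (S k) * / INR (S (S k)))
        by (apply Rmult_le_pos; [lra | left; apply I]).
      split; [apply Rmult_le_pos; lra | apply Rmult_le_compat; lra].
    + apply Rmult_le_pos; [apply Rmult_le_pos|]; [apply harmonic_nonneg | |];
        left; [apply I | apply J].
  - rewrite harmonic_S, harmonic_0. replace (n + 2)%nat with (S (n + 1)) by lia.
    assert (B : / INR (S (n + 1)) <= / INR (S n)).
    { apply Rinv_le_contravar; [apply INR_S_pos | apply le_INR; lia]. }
    assert (K := I (n + 1)%nat). simpl (INR 1). simpl (INR 2). rewrite Rinv_1. lra.
Qed.

(** The value of the sum over n >= 1 of (-1)^(n-1) / (n (n + k)). *)
Definition alt_kernel_inv (k : nat) : R :=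
  (ln 2 - (-1) ^ k * (ln 2 - alt_harmonic k 1)) * / INR k.

Definition partial_fraction_limit (p k : nat) : R :=
  sum1 (fun i => (-1) ^ (i - 1) * zeta_bar (p + 1 - i) * / INR k ^ i) (p - 1)
  + (-1) ^ (p - 1) * (alt_kernel_inv k * / INR k ^ (p - 1)).

(** Induction on p through 1 / (n^(p+1) (n + k)) = (1 / k) (1 / n^(p+1) - 1 / (n^p (n + k))): each
    step contributes one value of [zeta_bar] and flips the sign of the rest. *)
Lemma is_lim_partial_fraction p k : (1 <= p)%nat -> (1 <= k)%nat ->
  is_lim_seq (sum1 (fun n => - (-1) ^ n * / INR n ^ p * / INR (n + k)))
    (partial_fraction_limit p k).
Proof.
  intros Hp Hk. assert (Q := INR_pos k Hk).
  induction Hp as [|p Hp IH].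
  - apply is_lim_seq_ext with
      (fun M => - sum1 (fun n => (-1) ^ n * / INR n * / INR (k + n)) M).
    + intros M. replace (- sum1 (fun n => (-1) ^ n * / INR n * / INR (k + n)) M)
        with (-1 * sum1 (fun n => (-1) ^ n * / INR n * / INR (k + n)) M) by ring.
      rewrite <- sum1_scal. apply sum1_ext. intros n _. rewrite pow_1, Nat.add_comm. ring.
    + replace (Finite (partial_fraction_limit 1 k)) with
        (Rbar_opp (((-1) ^ k * (ln 2 - alt_harmonic k 1) - ln 2) / INR k)).
      * apply -> is_lim_seq_opp. now apply is_lim_alt_harmonic_inv.
      * unfold partial_fraction_limit, alt_kernel_inv. rewrite sum1_0. simpl.
        f_equal. unfold Rdiv. rewrite Rinv_1. ring.
  - apply is_lim_seq_ext with (fun M => / INR k *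
      (sum1 (fun n => - (-1) ^ n * / INR n ^ S p) M
       - sum1 (fun n => - (-1) ^ n * / INR n ^ p * / INR (n + k)) M)).
    + intros M. rewrite <- sum1_minus, <- sum1_scal. apply sum1_ext. intros n Hn.
      assert (P := INR_pos n ltac:(lia)). rewrite plus_INR. simpl pow.
      assert (0 < INR n ^ p) by now apply pow_lt. field. lra.
    + replace (Finite (partial_fraction_limit (S p) k)) with
        (Finite (/ INR k * (zeta_bar (S p) - partial_fraction_limit p k))).
      * apply (is_lim_seq_scal_l _ _ (Finite (zeta_bar (S p) - partial_fraction_limit p k))).
        apply is_lim_seq_minus'; [apply zeta_bar_lim; lia | exact IH].
      * f_equal. unfold partial_fraction_limit.
        replace (S p - 1)%nat with (S (p - 1)) by lia.
        rewrite sum1_shift.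
        rewrite (sum1_ext (fun i => (-1) ^ (S i - 1) * zeta_bar (S p + 1 - S i) * / INR k ^ S i)
          (fun i => - / INR k * ((-1) ^ (i - 1) * zeta_bar (p + 1 - i) * / INR k ^ i))).
        -- rewrite sum1_scal. replace (S p + 1 - 1)%nat with (S p) by lia.
           simpl pow. rewrite !Rinv_mult, ?Rinv_1. ring.
        -- intros i Hi. replace (S i - 1)%nat with (S (i - 1)) by lia.
           replace (S p + 1 - S i)%nat with (p + 1 - i)%nat by lia.
           simpl pow. rewrite Rinv_mult. ring.
Qed.

Lemma partial_fraction_bound p k M :
  Rabs (sum1 (fun n => - (-1) ^ n * / INR n ^ p * / INR (n + k)) M) <= / INR (S k).
Proof.
  rewrite (sum1_ext _ (fun n => -1 * ((-1) ^ n * (/ INR n ^ p * / INR (n + k)))))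
    by (intros; ring).
  rewrite sum1_scal, Rabs_mult, Rabs_m1, Rmult_1_l.
  assert (I : forall n, (1 <= n)%nat -> 0 < / INR n ^ p)
    by (intros n Hn; apply Rinv_0_lt_compat, pow_lt, INR_pos, Hn).
  assert (J : forall n, (1 <= n)%nat -> 0 < / INR (n + k))
    by (intros n Hn; apply Rinv_0_lt_compat, INR_pos; lia).
  assert (E : / INR 1 ^ p * / INR (1 + k) = / INR (S k))
    by (simpl (INR 1); rewrite pow1, Rinv_1, Rmult_1_l; reflexivity).
  rewrite <- E. apply (leibniz_bound (fun n => / INR n ^ p * / INR (n + k))).
  - intros n Hn. assert (I1 := I n Hn). assert (I2 := I (S n) ltac:(lia)).
    assert (J1 := J n Hn). assert (J2 := J (S n) ltac:(lia)).
    split; [apply Rmult_le_pos; lra|]. apply Rmult_le_compat; try lra.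
    + apply Rinv_le_contravar; [apply pow_lt, INR_pos, Hn|].
      apply pow_incr. rewrite S_INR. assert (P := INR_pos n Hn). lra.
    + apply Rinv_le_contravar; [apply INR_pos; lia | apply le_INR; lia].
  - rewrite E. left. apply Rinv_0_lt_compat, INR_S_pos.
Qed.

(** Both iterated sums are limits of the same sum over n, k <= M. The convergence is recorded as
    well, so that the right-hand total can be evaluated later. *)
Lemma partial_fraction_exchange p : (1 <= p)%nat ->
  euler (fun n => star_limit n - ln 2 ^ 2 / 2 * (-1) ^ n) (S p)
    = total (fun k => (-1) ^ k * harmonic (k - 1) * / INR k * partial_fraction_limit p k) /\
  is_lim_seq
    (sum1 (fun k => (-1) ^ k * harmonic (k - 1) * / INR k * partial_fraction_limit p k))
    (total (fun k => (-1) ^ k * harmonic (k - 1) * / INR k * partial_fraction_limit p k)).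
Proof.
  intros Hp.
  (* Summation over k first: the factor 1 / n^p and the bound 1 / (n + 1) on the inner sum give the
     majorant. *)
  destruct (tannery_total (fun M n => - (-1) ^ n * / INR n ^ p
    * sum1 (fun k => (-1) ^ k * harmonic (k - 1) * / INR k * / INR (n + k)) M)
    (fun n => (star_limit n - ln 2 ^ 2 / 2 * (-1) ^ n) * / INR n ^ S p) 1) as [_ H1].
  { intros M n Hn. apply inv_le_harmonic_sq; [exact Hn| |lra].
    assert (B := alt_harmonic_shift_inv_bound n M).
    rewrite !Rabs_mult, Rabs_Ropp, Rabs_pow_m1, Rmult_1_l.
    assert (P := INR_ge_1 n Hn).
    rewrite (Rabs_pos_eq (/ INR n ^ p)) by (left; apply Rinv_0_lt_compat, pow_lt; lra).
    replace (1 / INR n ^ 2) with (/ INR n * / INR n) by (field; lra).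
    apply Rmult_le_compat.
    - left; apply Rinv_0_lt_compat, pow_lt; lra.
    - apply Rabs_pos.
    - apply Rinv_le_contravar; [lra|]. rewrite <- (pow_1 (INR n)) at 1.
      now apply Rle_pow.
    - eapply Rle_trans; [exact B|].
      apply Rinv_le_contravar; [lra | apply le_INR; lia]. }
  { intros n Hn.
    replace (Finite ((star_limit n - ln 2 ^ 2 / 2 * (-1) ^ n) * / INR n ^ S p)) with
      (Rbar_mult (Finite (- (-1) ^ n * / INR n ^ p))
        (Finite ((ln 2 ^ 2 / 2 - (-1) ^ n * star_limit n) / INR n))).
    - apply is_lim_seq_scal_l. now apply is_lim_alt_harmonic_shift_inv.
    - simpl. f_equal. simpl pow. rewrite Rinv_mult. unfold Rdiv.
      transitivity (((-1) ^ n * (-1) ^ n * star_limit n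
        - ln 2 * (ln 2 * 1) * / 2 * (-1) ^ n) * (/ INR n * / INR n ^ p));
        [|rewrite pow_m1_sq]; ring. }
  (* Summation over n first: the inner sum is at most 1 / (k + 1), and H_(k-1) / k supplies the rest
     of the majorant. *)
  destruct (tannery_total (fun M k => (-1) ^ k * harmonic (k - 1) * / INR k
    * sum1 (fun n => - (-1) ^ n * / INR n ^ p * / INR (n + k)) M)
    (fun k => (-1) ^ k * harmonic (k - 1) * / INR k * partial_fraction_limit p k) 1)
    as [H3 H2].
  { intros M k Hk. assert (B := partial_fraction_bound p k M).
    rewrite !Rabs_mult, Rabs_pow_m1, !Rmult_1_l.
    assert (P := INR_pos k Hk). assert (I := Rinv_0_lt_compat _ P).
    rewrite (Rabs_pos_eq (/ INR k)), (Rabs_pos_eq (harmonic _))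
      by (try apply harmonic_nonneg; lra).
    replace (harmonic k / INR k ^ 2) with (harmonic k * / INR k * / INR k) by (field; lra).
    assert (Hh : harmonic (k - 1) <= harmonic k) by (rewrite harmonic_pred by exact Hk; lra).
    assert (N := harmonic_nonneg (k - 1)).
    apply Rmult_le_compat.
    - apply Rmult_le_pos; lra.
    - apply Rabs_pos.
    - apply Rmult_le_compat_r; lra.
    - eapply Rle_trans; [exact B|].
      apply Rinv_le_contravar; [lra | apply le_INR; lia]. }
  { intros k Hk. apply (is_lim_seq_scal_l _ _ (Finite (partial_fraction_limit p k))).
    now apply is_lim_partial_fraction. }
  split; [|exact H3]. unfold euler.
  eapply is_lim_seq_eq; [exact H1|].
  eapply is_lim_seq_ext; [|exact H2]. intros M. symmetry.
  rewrite (sum1_ext _ (fun n => sum1 (fun k => - (-1) ^ n * / INR n ^ p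
    * ((-1) ^ k * harmonic (k - 1) * / INR k * / INR (n + k))) M))
    by (intros; now rewrite sum1_scal).
  rewrite sum1_swap. apply sum1_ext. intros k _. rewrite <- sum1_scal.
  apply sum1_ext. intros; ring.
Qed.

Lemma is_lim_alt_harmonic_pred s : (2 <= s)%nat ->
  is_lim_seq (sum1 (fun k => (-1) ^ k * harmonic (k - 1) * / INR k ^ s))
    (zeta_star [Bar s; Plain 1] + zeta_bar (S s)).
Proof.
  intros Hs. rewrite zeta_star_bar_plain.
  apply is_lim_seq_ext with (fun M => sum1 (fun k => (-1) ^ k * harmonic k * / INR k ^ s) M
    + sum1 (fun n => - (-1) ^ n * / INR n ^ S s) M).
  - intros M. rewrite <- sum1_plus. apply sum1_ext. intros k Hk.
    rewrite (harmonic_pred k) by lia. simpl pow. rewrite Rinv_mult. ring.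
  - apply is_lim_seq_plus'; [|apply zeta_bar_lim; lia].
    apply (euler_lim (fun k => (-1) ^ k * harmonic k)); [exact Hs|].
    apply dominated_mult; [apply Rabs_pow_m1_le | apply dominated_harmonic].
Qed.

(** The sign (-1)^k meets itself in the second half of [alt_kernel_inv], which produces the
    non-alternating sum of H_k L_k. Replacing H_(k-1) by H_k - 1 / k gives the terms with exponent p
    + 2. *)
Lemma is_lim_harmonic_pred_kernel p : (1 <= p)%nat ->
  is_lim_seq (sum1 (fun k => (-1) ^ k * harmonic (k - 1) * alt_kernel_inv k * / INR k ^ p))
    (ln 2 * (zeta_star [Bar (S p); Plain 1] + zeta_bar (S (S p)))
     - ln 2 * (zeta_star [Plain (S p); Plain 1] - zeta (S (S p)))
     + (euler (fun n => harmonic n * alt_harmonic n 1) (S p)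
        + zeta_star [Plain (S (S p)); Bar 1])).
Proof.
  intros Hp.
  apply is_lim_seq_ext with (fun M =>
    ln 2 * sum1 (fun k => (-1) ^ k * harmonic (k - 1) * / INR k ^ S p) M
    - ln 2 * (sum1 (fun k => harmonic k * / INR k ^ S p) M
              - sum1 (fun k => 1 * / INR k ^ S (S p)) M)
    + (sum1 (fun k => harmonic k * alt_harmonic k 1 * / INR k ^ S p) M
       - sum1 (fun k => alt_harmonic k 1 * / INR k ^ S (S p)) M)).
  - intros M. rewrite <- !sum1_minus, <- !sum1_scal, <- sum1_minus, <- sum1_plus.
    apply sum1_ext. intros k Hk. unfold alt_kernel_inv.
    rewrite (harmonic_pred k) by lia. simpl pow. rewrite !Rinv_mult.
    assert (E := pow_m1_sq k). set (e := (-1) ^ k) in *.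
    set (i := / INR k). set (j := / INR k ^ p). set (h := harmonic k).
    set (l := alt_harmonic k 1).
    transitivity ((e * (h - i) * ln 2 - (e * e) * (h - i) * (ln 2 - l)) * i * j);
      [rewrite E|]; ring.
  - rewrite zeta_star_plain_bar, zeta_star_plain_plain, (zeta_euler (S (S p))).
    assert (D1 := dominated_alt_harmonic 1).
    apply is_lim_seq_plus'.
    + apply is_lim_seq_minus'.
      * apply (is_lim_seq_scal_l _ _ (Finite (zeta_star [Bar (S p); Plain 1]
          + zeta_bar (S (S p))))).
        apply is_lim_alt_harmonic_pred. lia.
      * apply (is_lim_seq_scal_l _ _
          (Finite (euler harmonic (S p) - euler (fun _ => 1) (S (S p))))).
        apply is_lim_seq_minus'.
        -- apply euler_lim; [lia | apply dominated_harmonic].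
        -- apply (euler_lim (fun _ => 1)); [lia | apply dominated_1].
    + apply is_lim_seq_minus'.
      * apply (euler_lim (fun n => harmonic n * alt_harmonic n 1));
          [lia | apply dominated_harmonic_alt_harmonic].
      * apply (euler_lim (fun n => alt_harmonic n 1)); [lia | exact D1].
Qed.

(** The left side expands [star_limit], from summing over k first; the right side expands
    [partial_fraction_limit], from summing over n first. *)
Lemma partial_fraction_identity p : (1 <= p)%nat ->
  ln 2 ^ 2 / 2 * (zeta (S p) + zeta_bar (S p)) + ln 2 * zeta_star [Plain (S p); Bar 1]
  - ln 2 * zeta_star [Plain (S p); Plain 1] + euler star_alt (S p)
  = sum1 (fun i => (-1) ^ (i - 1) * zeta_bar (p + 1 - i)
      * (zeta_star [Bar (S i); Plain 1] + zeta_bar (S (S i)))) (p - 1)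
    + (-1) ^ (p - 1)
      * (ln 2 * (zeta_star [Bar (S p); Plain 1] + zeta_bar (S (S p)))
         - ln 2 * (zeta_star [Plain (S p); Plain 1] - zeta (S (S p)))
         + (euler (fun n => harmonic n * alt_harmonic n 1) (S p)
            + zeta_star [Plain (S (S p)); Bar 1])).
Proof.
  intros Hp. destruct (partial_fraction_exchange p Hp) as [E H].
  transitivity (euler (fun n => star_limit n - ln 2 ^ 2 / 2 * (-1) ^ n) (S p)).
  - rewrite zeta_star_plain_bar, zeta_star_plain_plain, (zeta_euler (S p)),
      (zeta_bar_euler (S p)).
    set (c := ln 2 ^ 2 / 2).
    transitivity (euler (fun n => c * 1 + (c * (- (-1) ^ n)
      + ((- ln 2) * alt_harmonic n 1 + ((- ln 2) * harmonic n + star_alt n)))) (S p)).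
    + assert (DM : dominated (fun n => - (-1) ^ n)).
      { apply dominated_bounded. intros n. rewrite Rabs_Ropp. apply Rabs_pow_m1_le. }
      assert (D1 := dominated_alt_harmonic 1).
      repeat rewrite euler_plus; try lia;
        repeat first [ assumption | apply dominated_star_alt | apply dominated_1
                     | apply dominated_harmonic
                     | apply dominated_scal | apply dominated_plus ].
      rewrite !euler_scal. ring.
    + apply euler_ext. intros n _. unfold star_limit. fold c. ring.
  - rewrite E. eapply is_lim_seq_eq; [exact H|].
    apply is_lim_seq_ext with (fun M =>
      sum1 (fun i => (-1) ^ (i - 1) * zeta_bar (p + 1 - i)
        * sum1 (fun k => (-1) ^ k * harmonic (k - 1) * / INR k ^ S i) M) (p - 1)
      + (-1) ^ (p - 1)
        * sum1 (fun k => (-1) ^ k * harmonic (k - 1) * alt_kernel_inv k * / INR k ^ p) M).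
    + intros M.
      rewrite (sum1_ext _ (fun i => sum1 (fun k => (-1) ^ (i - 1) * zeta_bar (p + 1 - i)
        * ((-1) ^ k * harmonic (k - 1) * / INR k ^ S i)) M))
        by (intros; now rewrite sum1_scal).
      rewrite sum1_swap, <- sum1_scal, <- sum1_plus. apply sum1_ext. intros k _.
      unfold partial_fraction_limit. rewrite Rmult_plus_distr_l, <- sum1_scal. f_equal.
      * apply sum1_ext. intros i _. simpl pow. rewrite Rinv_mult. ring.
      * replace p with (S (p - 1)) at 2 by lia. simpl pow. rewrite Rinv_mult. ring.
    + apply is_lim_seq_plus'.
      * apply (is_lim_sum1_finite (fun M i => (-1) ^ (i - 1) * zeta_bar (p + 1 - i)
          * sum1 (fun k => (-1) ^ k * harmonic (k - 1) * / INR k ^ S i) M)).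
        intros i Hi.
        apply (is_lim_seq_scal_l _ _
          (Finite (zeta_star [Bar (S i); Plain 1] + zeta_bar (S (S i))))).
        apply is_lim_alt_harmonic_pred. lia.
      * apply (is_lim_seq_scal_l _ _ (Finite (ln 2 * (zeta_star [Bar (S p); Plain 1]
          + zeta_bar (S (S p))) - ln 2 * (zeta_star [Plain (S p); Plain 1]
          - zeta (S (S p))) + (euler (fun n => harmonic n * alt_harmonic n 1) (S p)
            + zeta_star [Plain (S (S p)); Bar 1])))).
        apply is_lim_harmonic_pred_kernel, Hp.
Qed.

(** * Elimination of the auxiliary Euler sum *)

Theorem theorem3p3 : forall p : nat, (1 <= p)%nat ->
  Series (fun n => alt_harmonic (S n) 1 ^ 2 / INR (S n) ^ (p + 1))
  + ((-1) ^ (p - 1) - 1)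
    * Series (fun n =>
        harmonic (S n) * alt_harmonic (S n) 1 / INR (S n) ^ (p + 1))
  =
  zeta_star [Plain (p + 1); Bar 2]
  - ln 2 * zeta_star [Plain (p + 1); Bar 1]
  + zeta_star [Bar (p + 2); Bar 1]
  + 1 / 2 * zeta 2 * zeta (p + 1)
  + sum_n_m (fun i => zeta_star [Bar i; Bar 1] * zeta_bar (p + 2 - i)) 1 (p + 1)
  + (INR p + 1 + (-1) ^ p) * zeta_star [Plain (p + 2); Bar 1]
  + 1 / 2 * ln 2 ^ 2 * (2 * zeta (p + 1) + zeta_bar (p + 1))
  + ln 2 * (-1) ^ (p - 1)
    * (zeta_star [Plain (p + 1); Plain 1] - zeta_star [Bar (p + 1); Plain 1])
  - sum_n_m (fun i =>
      (-1) ^ (i - 1) * zeta_bar (p + 1 - i) * zeta_star [Bar (i + 1); Plain 1])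
      1 (p - 1)
  - ln 2
    * (zeta_star [Plain (p + 1); Plain 1] - zeta_star [Plain (p + 1); Bar 1])
  - sum_n_m (fun i =>
      (-1) ^ (i - 1) * zeta_bar (p + 1 - i) * zeta_bar (i + 2)) 1 (p - 1)
  - ln 2 * (-1) ^ (p - 1) * (zeta (p + 2) + zeta_bar (p + 2)).
Proof.
  intros p Hp.
  assert (I := partial_fraction_identity p Hp).
  assert (II := convolution_identity (S p) ltac:(lia)).
  change (sum_n_m (fun i => zeta_star [Bar i; Bar 1] * zeta_bar (p + 2 - i)) 1 (p + 1))
    with (sum1 (fun i => zeta_star [Bar i; Bar 1] * zeta_bar (p + 2 - i)) (p + 1)).
  change (sum_n_m (fun i => (-1) ^ (i - 1) * zeta_bar (p + 1 - i)
      * zeta_star [Bar (i + 1); Plain 1]) 1 (p - 1))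
    with (sum1 (fun i => (-1) ^ (i - 1) * zeta_bar (p + 1 - i)
      * zeta_star [Bar (i + 1); Plain 1]) (p - 1)).
  change (sum_n_m (fun i => (-1) ^ (i - 1) * zeta_bar (p + 1 - i) * zeta_bar (i + 2))
      1 (p - 1))
    with (sum1 (fun i => (-1) ^ (i - 1) * zeta_bar (p + 1 - i) * zeta_bar (i + 2)) (p - 1)).
  change (Series (fun n => alt_harmonic (S n) 1 ^ 2 / INR (S n) ^ (p + 1)))
    with (euler (fun n => alt_harmonic n 1 ^ 2) (p + 1)).
  change (Series (fun n => harmonic (S n) * alt_harmonic (S n) 1 / INR (S n) ^ (p + 1)))
    with (euler (fun n => harmonic n * alt_harmonic n 1) (p + 1)).
  (* The statement lists separately the two sums over i that [I] contains as one. *)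
  rewrite (sum1_ext _ (fun i =>
    (-1) ^ (i - 1) * zeta_bar (p + 1 - i) * zeta_star [Bar (i + 1); Plain 1]
    + (-1) ^ (i - 1) * zeta_bar (p + 1 - i) * zeta_bar (i + 2))), sum1_plus in I.
  2:{ intros i _. replace (S (S i)) with (i + 2)%nat by lia.
      replace (S i) with (i + 1)%nat by lia. ring. }
  replace (S (S p)) with (p + 2)%nat in * by lia.
  replace (S p) with (p + 1)%nat in * by lia.
  rewrite plus_INR in II. simpl (INR 1) in II.
  assert (E : (-1) ^ p = - (-1) ^ (p - 1)).
  { replace p with (S (p - 1)) at 1 by lia. simpl. ring. }
  (* The sum [euler star_alt (p + 1)] has coefficient 1 in both [I] and [II], so it cancels in their
     difference, which is the claim; the remaining products act as atoms for [lra]. *)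
  rewrite E. lra.
Qed.
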